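(* Let $\mathcal{T}$ be a simplicial tree and $G \leq \mathrm{Aut}(\mathcal{T})$. Suppose that the action of $G$ on $\mathcal{T}$ is minimal and of general type, and that the action of $G$ on $\partial \mathcal{T}$ is not topologically free. Assume that $G$ acts faithfully and $3$-transitively on a set $\Omega$. Then there exists a $G$-orbit $\mathcal{O} \subset \partial \mathcal{T}$ such that the actions of $G$ on $\Omega$ and on $\mathcal{O}$ are conjugate.
   Context: An automorphism of $\mathcal{T}$ is elliptic if it stabilizes a vertex or an edge, and hyperbolic if it acts as a non-trivial translation along a bi-infinite geodesic (its axis), whose two ends are its endpoints. The action of $G$ on $\mathcal{T}$ is minimal if there is no proper $G$-invariant subtree; it is of general type if $G$ contains two hyperbolic elements having no common endpoint. $\partial\mathcal{T}$ is the space of ends of $\mathcal{T}$ with its usual topology; the action on $\partial\mathcal{T}$ is topologically free if the fixed point set in $\partial\mathcal{T}$ of every non-trivial element of $G$ has empty interior. An action on $\Omega$ is $3$-transitive if $G$ acts transitively on ordered triples of distinct elements of $\Omega$. Two actions are conjugate if there is a $G$-equivariant bijection between the sets. *)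

(* Defs.v *)
From Stdlib Require Import ZArith.
Open Scope Z_scope.

Section Trees.
Variable V : Type.
Variable adj : V -> V -> Prop.

Definition is_walk (p : nat -> V) (n : nat) : Prop :=
  forall i : nat, (i < n)%nat -> adj (p i) (p (S i)).

Definition is_reduced_walk (p : nat -> V) (n : nat) : Prop :=
  is_walk p n /\ forall i : nat, (S (S i) <= n)%nat -> p (S (S i)) <> p i.

Definition is_simplicial_tree : Prop :=
  (forall x y, adj x y -> adj y x) /\
  (forall x, ~ adj x x) /\
  (forall x y, exists (p : nat -> V) (n : nat), p O = x /\ p n = y /\ is_walk p n) /\
  (forall (p : nat -> V) (n : nat), (1 <= n)%nat -> is_reduced_walk p n -> p O <> p n).

Definition is_automorphism (g : V -> V) : Prop :=
  (forall x y, adj x y <-> adj (g x) (g y)) /\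
  (forall x y, g x = g y -> x = y) /\
  (forall y, exists x, g x = y).

Definition is_aut_subgroup (G : (V -> V) -> Prop) : Prop :=
  (forall g, G g -> is_automorphism g) /\
  G (fun x => x) /\
  (forall g h, G g -> G h -> G (fun x => g (h x))) /\
  (forall g, G g -> exists h, G h /\ (forall x, g (h x) = x) /\ (forall x, h (g x) = x)).

(** Geodesic rays (representatives of ends) and their equivalence (cofinality). *)
Definition is_ray (r : nat -> V) : Prop :=
  forall i : nat, adj (r i) (r (S i)) /\ r (S (S i)) <> r i.

Definition ray_equiv (r r' : nat -> V) : Prop :=
  exists i j : nat, forall n : nat, r (i + n)%nat = r' (j + n)%nat.

Definition is_geodesic_line (l : Z -> V) : Prop :=
  forall k : Z, adj (l k) (l (k + 1)) /\ l (k + 2) <> l k.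

Definition plus_end (l : Z -> V) : nat -> V := fun n => l (Z.of_nat n).
Definition minus_end (l : Z -> V) : nat -> V := fun n => l (- Z.of_nat n).

Definition hyperbolic_with_axis (g : V -> V) (l : Z -> V) : Prop :=
  is_geodesic_line l /\ exists t : Z, 0 < t /\ forall k : Z, g (l k) = l (k + t).

Definition common_endpoint (l1 l2 : Z -> V) : Prop :=
  ray_equiv (plus_end l1) (plus_end l2) \/ ray_equiv (plus_end l1) (minus_end l2) \/
  ray_equiv (minus_end l1) (plus_end l2) \/ ray_equiv (minus_end l1) (minus_end l2).

Definition general_type (G : (V -> V) -> Prop) : Prop :=
  exists g h l1 l2, G g /\ G h /\ hyperbolic_with_axis g l1 /\
    hyperbolic_with_axis h l2 /\ ~ common_endpoint l1 l2.

Definition is_subtree (S : V -> Prop) : Prop :=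
  (exists v, S v) /\
  (forall x y, S x -> S y -> exists (p : nat -> V) (n : nat),
      p O = x /\ p n = y /\ is_walk p n /\ forall i, (i <= n)%nat -> S (p i)).

Definition minimal_action (G : (V -> V) -> Prop) : Prop :=
  forall S : V -> Prop, is_subtree S ->
    (forall g v, G g -> S v -> S (g v)) -> forall v, S v.

(** Topology on the space of ends.  An end is represented by a ray up to
    ray_equiv.  For an oriented edge (v,w), the shadow [shadow v w] is the set
    of ends whose geodesic ray issued from v passes through w; these sets form
    a basis of the usual topology on the space of ends.  A set of rays U is
    open if each of its members lies in a shadow contained in U. *)
Definition shadow (v w : V) (r : nat -> V) : Prop :=
  exists r', is_ray r' /\ ray_equiv r r' /\ r' O = v /\ r' 1%nat = w.

Definition end_open (U : (nat -> V) -> Prop) : Prop :=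
  forall r, is_ray r -> U r -> exists v w, adj v w /\ shadow v w r /\
    forall r', is_ray r' -> shadow v w r' -> U r'.

Definition fixes_end (g : V -> V) (r : nat -> V) : Prop :=
  ray_equiv (fun n => g (r n)) r.

Definition topologically_free (G : (V -> V) -> Prop) : Prop :=
  forall g, G g -> (exists v, g v <> v) ->
    forall U, end_open U -> (forall r, is_ray r -> U r -> fixes_end g r) ->
      forall r, is_ray r -> ~ U r.

End Trees.

Definition is_action {V Omega : Type} (G : (V -> V) -> Prop)
    (act : (V -> V) -> Omega -> Omega) : Prop :=
  (forall w, act (fun x => x) w = w) /\
  (forall g h w, G g -> G h -> act (fun x => g (h x)) w = act g (act h w)).

Definition faithful_action {V Omega : Type} (G : (V -> V) -> Prop)
    (act : (V -> V) -> Omega -> Omega) : Prop :=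
  forall g, G g -> (forall w, act g w = w) -> forall v, g v = v.

Definition three_transitive {V Omega : Type} (G : (V -> V) -> Prop)
    (act : (V -> V) -> Omega -> Omega) : Prop :=
  forall a1 a2 a3 b1 b2 b3 : Omega,
    a1 <> a2 -> a1 <> a3 -> a2 <> a3 -> b1 <> b2 -> b1 <> b3 -> b2 <> b3 ->
    exists g, G g /\ act g a1 = b1 /\ act g a2 = b2 /\ act g a3 = b3.

Definition conjugate_to_orbit {V Omega : Type} (adj : V -> V -> Prop)
    (G : (V -> V) -> Prop) (act : (V -> V) -> Omega -> Omega)
    (xi0 : nat -> V) : Prop :=
  exists phi : Omega -> (nat -> V),
    (forall w, is_ray V adj (phi w)) /\
    (forall w, exists g, G g /\ ray_equiv V (phi w) (fun n => g (xi0 n))) /\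
    (forall g, G g -> exists w, ray_equiv V (phi w) (fun n => g (xi0 n))) /\
    (forall w w', ray_equiv V (phi w) (phi w') -> w = w') /\
    (forall g w, G g -> ray_equiv V (phi (act g w)) (fun n => g (phi w n))).

(* Main.v *)
(* For a half-tree X let G_X be the group of elements of G supported in X; as the action
   on the ends is not topologically free, minimality and general type make every G_X
   non-trivial.  Let H be the stabilizer of a point o of Omega.
   Either H fixes an end, and then H is its full stabilizer since H is maximal, or H
   preserves a non-empty set of vertices contained in a half-tree, or H moves any half-tree
   into any other.  The second case is excluded by 2-transitivity, all pairs of distinct
   translates of the invariant set being equidistant.  In the third case, either all G_X
   act freely on o, and conjugating inside H so as to match prescribed images of o
   contradicts freeness; or every H_X (the intersection of H and G_X) is non-trivial.
   As two disjoint half-trees and two further ones always contain a disjoint cross pair,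
   3-transitivity then forces the subsets of Omega moved by H_X and H_Y to be disjoint for
   disjoint X, Y, so that each point other than o determines an end, and for commuting
   a, b in G_X, G_Y the point a^-1 b o is incompatible with a^-1 o and b o. *)

From Stdlib Require Import ZArith Lia Classical ClassicalEpsilon FunctionalExtensionality.
Require Import Defs.

(** * Half-trees *)

Section HalfTrees.
Context {V : Type}.
Variable adj : V -> V -> Prop.

Definition incl (A B : V -> Prop) : Prop := forall x, A x -> B x.
Definition disj (A B : V -> Prop) : Prop := forall x, A x -> B x -> False.

(** The half-tree [side v w]: the component containing [w] of the tree with the
    edge between [v] and [w] removed. *)
Inductive side (v w : V) : V -> Prop :=
| side_head : side v w w
| side_step x y : side v w x -> adj x y -> ~ (x = w /\ y = v) -> side v w y.

Lemma side_incl_of_cross (v w : V) (A : V -> Prop) :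
  A w -> (forall x y, side v w y -> A x -> adj x y -> A y) -> incl (side v w) A.
Proof.
  intros Hw HA x Hx. induction Hx as [|x y Hx IH Hxy Hne]; [exact Hw|].
  apply (HA x y); auto. now apply side_step with x.
Qed.

Lemma side_cross v w x y :
  side v w x -> adj x y -> ~ side v w y -> x = w /\ y = v.
Proof.
  intros Hx Hxy Hy. apply NNPP. intros H. apply Hy. now apply side_step with x.
Qed.

(** The index is the length of a possibly backtracking walk; it serves as an upper bound for the
    distance. *)
Inductive within : nat -> V -> V -> Prop :=
| within_refl x : within O x x
| within_step n x y z : within n x y -> adj y z -> within (S n) x z.

Definition supported (A : V -> Prop) (g : V -> V) : Prop :=
  forall x, ~ A x -> g x = x.

Lemma supported_mono (A B : V -> Prop) g : incl A B -> supported A g -> supported B g.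
Proof. intros HAB Hg x Hx. apply Hg. auto. Qed.

Lemma supported_inverse (A : V -> Prop) (g g' : V -> V) :
  (forall x, g' (g x) = x) -> supported A g -> supported A g'.
Proof. intros Hg HA x Hx. rewrite <- (HA x Hx) at 1. apply Hg. Qed.

Lemma supported_comp (A : V -> Prop) (g h : V -> V) :
  supported A g -> supported A h -> supported A (fun x => g (h x)).
Proof. intros Hg Hh x Hx. rewrite (Hh x Hx). auto. Qed.

(** An injective map preserves the set supporting it, so each factor acts trivially wherever the
    other one moves points. *)
Lemma supported_commute (A B : V -> Prop) (g h : V -> V) :
  (forall x y, g x = g y -> x = y) -> (forall x y, h x = h y -> x = y) ->
  disj A B -> supported A g -> supported B h -> forall x, g (h x) = h (g x).
Proof.
  assert (stable : forall (C : V -> Prop) k, (forall x y, k x = k y -> x = y) ->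
            supported C k -> forall x, C x -> C (k x)).
  { intros C k Hk HC x Hx. apply NNPP. intros H.
    pose proof (HC _ H) as E. apply Hk in E. rewrite E in H. auto. }
  intros Hg Hh HAB HA HB x.
  destruct (classic (A x)) as [Ax|Ax].
  - rewrite (HB x) by (intros Bx; apply (HAB x); auto).
    symmetry. apply HB. intros Bx. apply (HAB (g x)); [now apply (stable A)|exact Bx].
  - rewrite (HA x Ax). destruct (classic (B x)) as [Bx|Bx].
    + apply HA. intros Ahx. apply (HAB (h x)); [exact Ahx|now apply (stable B)].
    + rewrite (HB x Bx). auto.
Qed.

Hypothesis tree : is_simplicial_tree V adj.

Lemma adj_sym x y : adj x y -> adj y x.
Proof. apply tree. Qed.

Lemma adj_irrefl x : ~ adj x x.
Proof. apply tree. Qed.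

Lemma tree_ind (x : V) (P : V -> Prop) :
  P x -> (forall y z, adj y z -> P y -> P z) -> forall y, P y.
Proof.
  intros Hx Hstep y. destruct tree as (_ & _ & conn & _).
  destruct (conn x y) as (p & n & H0 & Hn & Hw). subst.
  assert (H : forall i, (i <= n)%nat -> P (p i)).
  { induction i as [|i IH]; intros Hi; [exact Hx|].
    apply (Hstep (p i)); [apply Hw; lia | apply IH; lia]. }
  apply H. lia.
Qed.

(** A step back to the last but one vertex shortens the walk, any other step extends it; only the
    excluded crossing from [w] to [v] could shrink it to length zero. *)
Lemma side_reduced_walk v w x : adj v w -> side v w x ->
  exists p n, (1 <= n)%nat /\ p O = v /\ p 1%nat = w /\ p n = x /\
    is_reduced_walk V adj p n.
Proof.
  intros Hvw Hx. induction Hx as [|x y Hx IH Hxy Hne].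
  - exists (fun n => match n with O => v | _ => w end), 1%nat.
    repeat split; auto; intros i Hi.
    + assert (i = O) by lia. subst. exact Hvw.
    + lia.
  - destruct IH as (p & n & Hn & H0 & H1 & Hpn & Hw & Hr).
    destruct (classic (p (n - 1)%nat = y)) as [E|E].
    + assert (n <> 1)%nat.
      { intros ->. apply Hne. split; [congruence|]. simpl in E. congruence. }
      exists p, (n - 1)%nat. repeat split; auto; try lia.
      * intros i Hi. apply Hw. lia.
      * intros i Hi. apply Hr. lia.
    + exists (fun i => if Nat.eqb i (S n) then y else p i), (S n).
      assert (Hlt : forall i, (i <= n)%nat -> Nat.eqb i (S n) = false)
        by (intros i Hi; apply Nat.eqb_neq; lia).
      rewrite (Hlt O), (Hlt 1%nat), Nat.eqb_refl by lia.
      repeat split; auto; try lia; intros i Hi.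
      * rewrite (Hlt i) by lia.
        destruct (Nat.eqb_spec (S i) (S n)) as [Ei|Ei].
        -- replace i with n by lia. congruence.
        -- apply Hw. lia.
      * rewrite (Hlt i) by lia.
        destruct (Nat.eqb_spec (S (S i)) (S n)) as [Ei|Ei].
        -- replace i with (n - 1)%nat by lia. congruence.
        -- apply Hr. lia.
Qed.

Lemma side_root v w : adj v w -> ~ side v w v.
Proof.
  intros Hvw Hv. destruct (side_reduced_walk v w v Hvw Hv) as (p & n & Hn & H0 & _ & Hpn & Hr).
  destruct tree as (_ & _ & _ & acyclic). apply (acyclic p n Hn Hr). congruence.
Qed.

Lemma side_cover v w x : adj v w -> side v w x \/ side w v x.
Proof.
  intros Hvw. revert x. apply (tree_ind v).
  - right. constructor.
  - intros y z Hyz [Hy|Hy].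
    + destruct (classic (side v w z)) as [Hz|Hz]; auto.
      destruct (side_cross _ _ _ _ Hy Hyz Hz) as [-> ->]. right. constructor.
    + destruct (classic (side w v z)) as [Hz|Hz]; auto.
      destruct (side_cross _ _ _ _ Hy Hyz Hz) as [-> ->]. left. constructor.
Qed.

Lemma side_disj v w : adj v w -> disj (side v w) (side w v).
Proof.
  intros Hvw x Hx. induction Hx as [|x y Hx IH Hxy Hne].
  - apply side_root. now apply adj_sym.
  - intros Hy. apply Hne.
    destruct (side_cross w v y x Hy (adj_sym _ _ Hxy)) as [-> ->]; auto.
Qed.

Lemma side_compl v w x : adj v w -> (side w v x <-> ~ side v w x).
Proof.
  intros Hvw. split.
  - intros H1 H2. exact (side_disj v w Hvw x H2 H1).
  - destruct (side_cover v w x Hvw); tauto.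
Qed.

Lemma side_direction v x : v <> x -> exists w, adj v w /\ side v w x.
Proof.
  intros Hvx. enough (v = x \/ exists w, adj v w /\ side v w x) by tauto.
  clear Hvx. revert x. apply (tree_ind v); [now left|].
  intros y z Hyz [<-|(w & Hvw & Hy)].
  - right. exists z. split; [exact Hyz|constructor].
  - destruct (classic (side v w z)) as [Hz|Hz]; [right; eauto|].
    left. symmetry. apply (side_cross _ _ _ _ Hy Hyz Hz).
Qed.

Lemma side_direction_unique v w u x :
  adj v w -> adj v u -> side v w x -> side v u x -> w = u.
Proof.
  intros Hvw Hvu Hx. apply NNPP.
  enough (w <> u -> ~ side v u x) by tauto. intros Hne.
  induction Hx as [|x y Hx IH Hxy Hn]; intros H.
  - destruct (side_cross v u w v H (adj_sym _ _ Hvw) (side_root v u Hvu)). auto.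
  - destruct (side_cross v u y x H (adj_sym _ _ Hxy) IH) as [-> ->].
    exact (side_root v w Hvw Hx).
Qed.

(** [side v w] can be left only by stepping onto [v], which [side p q] avoids. *)
Lemma side_incl v w p q : side v w q -> ~ side p q v -> incl (side p q) (side v w).
Proof.
  intros Hq Hv. apply side_incl_of_cross; [exact Hq|].
  intros x y Hy Hx Hxy. apply NNPP. intros H.
  destruct (side_cross _ _ _ _ Hx Hxy H) as [_ ->]. auto.
Qed.

Lemma side_incl_next v w u : adj v w -> adj w u -> u <> v -> incl (side w u) (side v w).
Proof.
  intros Hvw Hwu Hne. apply side_incl.
  - apply side_step with w; [constructor|exact Hwu|]. intros [_ E]. auto.
  - intros H. apply Hne. apply (side_direction_unique w u v v); auto using adj_sym.
    constructor.
Qed.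

Lemma side_disj_fork v w u : adj v w -> adj v u -> w <> u -> disj (side v w) (side v u).
Proof. intros Hw Hu Hne x H1 H2. apply Hne. eapply side_direction_unique; eauto. Qed.

(** Two oriented edges have four relative positions; in the last one the half-trees together cover
    the tree. *)
Lemma side_nested v w p q : adj v w -> adj p q ->
  incl (side v w) (side p q) \/ incl (side p q) (side v w) \/
  disj (side v w) (side p q) \/ (incl (side w v) (side p q) /\ incl (side q p) (side v w)).
Proof.
  intros Hvw Hpq.
  destruct (classic (side v w q)) as [Hq|Hq].
  - destruct (classic (side p q v)) as [Hv|Hv].
    2: { right; left. now apply side_incl. }
    destruct (classic (side v w p)) as [Hp|Hp].
    + right; right; right. split.
      * apply side_incl; [exact Hv|]. rewrite side_compl; auto.
      * apply side_incl; [exact Hp|]. rewrite side_compl; auto.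
    + destruct (side_cross v w q p Hq (adj_sym _ _ Hpq) Hp) as [-> ->].
      left. intros x Hx. exact Hx.
  - destruct (classic (side p q w)) as [Hw|Hw].
    + destruct (classic (side v w p)) as [Hp|Hp].
      * destruct (side_cross v w p q Hp Hpq Hq) as [-> ->].
        right; right; left. now apply side_disj.
      * left. now apply side_incl.
    + right; right; left.
      assert (H : incl (side p q) (side w v)).
      { apply side_incl; [|exact Hw]. rewrite side_compl; auto. }
      intros x H1 H2. apply (side_disj v w Hvw x); auto.
Qed.

Lemma side_automorphism g v w x : is_automorphism V adj g ->
  side v w x -> side (g v) (g w) (g x).
Proof.
  intros (Hadj & Hinj & _) Hx. induction Hx as [|x y Hx IH Hxy Hne]; [constructor|].
  apply side_step with (g x); auto.
  - now apply (proj1 (Hadj _ _)).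
  - intros [E1 E2]. apply Hne. auto.
Qed.

Lemma side_image g v w (A : V -> Prop) : is_automorphism V adj g -> adj v w ->
  (forall x, side v w x -> A (g x)) -> incl (side (g v) (g w)) A.
Proof.
  intros Hg Hvw HA y Hy. pose proof Hg as (Hadj & _ & Hsurj).
  destruct (Hsurj y) as [x <-]. apply HA. apply side_compl; [now apply adj_sym|].
  intros Hx. apply (side_disj (g v) (g w)) with (g x); auto.
  - now apply (proj1 (Hadj _ _)).
  - now apply side_automorphism.
Qed.

Lemma within_exists x y : exists n, within n x y.
Proof.
  revert y. apply (tree_ind x).
  - exists O. constructor.
  - intros y z Hyz (n & Hn). exists (S n). now apply within_step with y.
Qed.

Lemma within_automorphism g n x y : is_automorphism V adj g ->
  within n x y -> within n (g x) (g y).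
Proof.
  intros (Hadj & _) H. induction H; [constructor|].
  apply within_step with (g y); auto. now apply (proj1 (Hadj _ _)).
Qed.

(* Four non-disjoint cross pairs would form a cycle. *)
Lemma disjoint_cross_pair p1 q1 p2 q2 p3 q3 p4 q4 :
  adj p1 q1 -> adj p2 q2 -> adj p3 q3 -> adj p4 q4 ->
  disj (side p1 q1) (side p2 q2) -> disj (side p3 q3) (side p4 q4) ->
  disj (side p1 q1) (side p3 q3) \/ disj (side p1 q1) (side p4 q4) \/
  disj (side p2 q2) (side p3 q3) \/ disj (side p2 q2) (side p4 q4).
Proof.
  intros A1 A2 A3 A4 D12 D34.
  destruct (side_nested p1 q1 p3 q3 A1 A3) as [H|[H|[H|[H H']]]].
  - right; left. intros x Hx. apply D34. auto.
  - right; right; left. intros x Hx Hx'. apply (D12 x); auto.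
  - left. exact H.
  - right; right; right. intros x Hx. apply D34. apply H.
    rewrite side_compl by auto. intros Hx'. exact (D12 x Hx' Hx).
Qed.

(** According to the position of [side p q] relative to [side p1 q1], the half-tree found is one of
    these two or the complement of the latter. *)
Lemma half_tree_off_one_of_two p q p1 q1 p2 q2 :
  adj p q -> adj p1 q1 -> adj p2 q2 -> disj (side p1 q1) (side p2 q2) ->
  exists v w, adj v w /\ incl (side v w) (side p q) /\
    (disj (side v w) (side p1 q1) \/ disj (side v w) (side p2 q2)).
Proof.
  intros A A1 A2 D.
  destruct (side_nested p q p1 q1 A A1) as [H|[H|[H|[H H']]]].
  - exists p, q. repeat split; auto; [now intros x|].
    right. intros x Hx. apply D. auto.
  - exists p1, q1. auto.
  - exists p, q. repeat split; auto. now intros x.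
  - exists q1, p1. repeat split; auto using adj_sym.
    left. apply side_disj. auto using adj_sym.
Qed.

Section NoLeaf.
Hypothesis no_leaf : forall p q, adj p q -> exists r, adj q r /\ r <> p.

(** Prolonging the edge once puts one more step between the half-tree and [side p q]. *)
Lemma half_tree_far p q n : adj p q ->
  exists p' q', adj p' q' /\ incl (side p' q') (side q p) /\
    forall x z, within n x z -> side p' q' z -> side q p x.
Proof.
  intros Hpq. induction n as [|n (p' & q' & Hpq' & Hi & IH)].
  - exists q, p. split; [now apply adj_sym|]. split; [now intros x|].
    intros x z H. now inversion H.
  - destruct (no_leaf p' q' Hpq') as (r & Hqr & Hne).
    exists q', r. split; [exact Hqr|]. split.
    { intros x Hx. apply Hi. now apply (side_incl_next p' q' r). }
    intros x z H Hz.
    inversion H as [|n' x' y z' Hxy Hyz]; subst. apply (IH x y Hxy).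
    destruct (classic (side q' r y)) as [Hy|Hy].
    + now apply (side_incl_next p' q' r).
    + destruct (side_cross q' r z y Hz (adj_sym _ _ Hyz) Hy) as [_ ->]. constructor.
Qed.
End NoLeaf.

End HalfTrees.

(** * Ends *)

Section Ends.
Context {V : Type}.
Variable adj : V -> V -> Prop.
Hypothesis tree : is_simplicial_tree V adj.

Notation side := (side adj).
Notation within := (within adj).

(** An end is encoded by the map sending each vertex to the next vertex on the
    ray that leads from it to the end. *)
Definition end_map (f : V -> V) : Prop :=
  (forall v, adj v (f v)) /\ (forall v, f (f v) <> v) /\
  (forall v w, adj v w -> f v = w \/ f w = v).

(** A common source of ends and of invariant sets: a filter with a direction at every vertex is an
    end, and the vertices where it has none lie in all its members. *)
Definition half_tree_filter (M : V -> V -> Prop) : Prop :=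
  (forall p q, M p q -> adj p q) /\
  (forall p q p' q', adj p' q' -> M p q -> incl (side p q) (side p' q') -> M p' q') /\
  (forall p q p' q', M p q -> M p' q' -> ~ disj (side p q) (side p' q')).

Lemma filter_toward M v p q : half_tree_filter M -> M p q -> ~ side p q v ->
  exists w, M v w.
Proof.
  intros (Madj & Mup & _) Hpq Hv.
  destruct (side_direction adj tree v q) as (w & Hvw & Hw).
  - intros ->. apply Hv. constructor.
  - exists w. apply (Mup p q); auto. now apply side_incl.
Qed.

(** Distinct directions at one vertex, and opposite directions on one edge, give disjoint
    half-trees; the meeting condition leaves one direction per vertex and no backtracking. *)
Lemma filter_end M : half_tree_filter M -> (forall v, exists w, M v w) ->
  exists f, end_map f /\ forall v w, M v w <-> f v = w.
Proof.
  intros (Madj & Mup & Mmeet) Htot.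
  exists (fun v => proj1_sig (constructive_indefinite_description _ (Htot v))).
  set (f := fun v => proj1_sig (constructive_indefinite_description _ (Htot v))).
  assert (Hf : forall v, M v (f v)).
  { intros v. unfold f. now destruct (constructive_indefinite_description _ (Htot v)). }
  assert (Huniq : forall v w, M v w -> f v = w).
  { intros v w Hw. apply NNPP. intros Hne.
    apply (Mmeet _ _ _ _ (Hf v) Hw). apply side_disj_fork; auto. }
  split; [repeat split|].
  - intros v. apply Madj, Hf.
  - intros v E. pose proof (Hf (f v)) as H. rewrite E in H.
    apply (Mmeet _ _ _ _ (Hf v) H). apply side_disj; auto.
  - intros v w Hvw. apply NNPP. intros H.
    apply (Mmeet _ _ _ _ (Hf v) (Hf w)).
    assert (H1 : incl (side v (f v)) (side w v)).
    { apply side_incl_next; auto. apply (adj_sym adj tree); auto. }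
    assert (H2 : incl (side w (f w)) (side v w)).
    { apply side_incl_next; auto. }
    intros x Hx Hx'. apply (side_disj adj tree v w Hvw x); auto.
  - intros v w. split; [apply Huniq|]. intros <-. apply Hf.
Qed.

(** A vertex outside some member would get a direction toward it by upward closure, so the vertices
    without a direction form an invariant set inside every member. *)
Lemma invariant_filter_end_or_core (K : (V -> V) -> Prop) M p0 q0 :
  is_aut_subgroup V adj K -> half_tree_filter M ->
  (forall g p q, K g -> M p q -> M (g p) (g q)) -> M p0 q0 ->
  (exists f, end_map f /\ (forall v w, M v w <-> f v = w) /\
     forall g v, K g -> f (g v) = g (f v)) \/
  (exists S : V -> Prop, (exists s, S s) /\ incl S (side p0 q0) /\
     forall g s, K g -> S s -> S (g s)).
Proof.
  intros (Kaut & K1 & Kmul & Kinv) HM Minv H0.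
  destruct (classic (forall v, exists w, M v w)) as [Htot|Hcore].
  - left. destruct (filter_end M HM Htot) as (f & Hf & HMf).
    exists f. split; [exact Hf|split; [exact HMf|]].
    intros g v Hg. apply HMf. apply Minv; [exact Hg|]. now apply HMf.
  - right. exists (fun v => forall w, ~ M v w). repeat split.
    + apply not_all_ex_not in Hcore. destruct Hcore as [s Hs]. exists s. eauto.
    + intros v Hv. apply NNPP. intros H.
      destruct (filter_toward M v p0 q0 HM H0 H) as [w Hw]. exact (Hv w Hw).
    + intros g s Hg Hs w Hw. destruct (Kinv g Hg) as (g' & Hg' & _ & E).
      apply (Hs (g' w)). rewrite <- (E s). now apply Minv.
Qed.

Section EndMap.
Variable f : V -> V.
Hypothesis Hf : end_map f.

Lemma end_map_adj v : adj v (f v).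
Proof. apply Hf. Qed.

Lemma end_map_or v w : adj v w -> f v = w \/ f w = v.
Proof. apply Hf. Qed.

Lemma iter_end_map_side n x : side x (f x) (Nat.iter (S n) f x).
Proof.
  induction n as [|n IH]; [constructor|].
  apply side_step with (Nat.iter (S n) f x); [exact IH|apply end_map_adj|].
  intros [E1 E2]. simpl in *. rewrite E1 in E2. apply (proj1 (proj2 Hf) x E2).
Qed.

Lemma end_map_merge x y : exists i j, Nat.iter i f x = Nat.iter j f y.
Proof.
  revert y. apply (tree_ind adj tree x).
  - exists O, O. reflexivity.
  - intros y z Hyz (i & j & E). destruct (end_map_or y z Hyz) as [Ez|Ey].
    + exists (S i), j. simpl. rewrite E, <- Ez.
      clear. induction j as [|j IH]; simpl; congruence.
    + exists i, (S j). rewrite E, <- Ey. rewrite Nat.iter_succ_r. reflexivity.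
Qed.

Lemma iter_end_map_merge x y : exists i j, forall n,
  Nat.iter (i + n) f x = Nat.iter (j + n) f y.
Proof.
  destruct (end_map_merge x y) as (i & j & E). exists i, j. intros n.
  rewrite !(Nat.add_comm _ n), !Nat.iter_add. congruence.
Qed.

Lemma end_map_meet p p' : ~ disj (side p (f p)) (side p' (f p')).
Proof.
  intros D. destruct (iter_end_map_merge p p') as (i & j & E).
  specialize (E 1%nat). rewrite !(Nat.add_1_r) in E.
  apply (D (Nat.iter (S i) f p)).
  - apply iter_end_map_side.
  - rewrite E. apply iter_end_map_side.
Qed.

Lemma end_map_up v w p : adj v w -> incl (side p (f p)) (side v w) -> f v = w.
Proof.
  intros Hvw Hi. destruct (end_map_or v w Hvw) as [E|E]; [exact E|].
  exfalso. apply (end_map_meet p w). rewrite E.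
  intros x Hx. apply (side_disj adj tree v w Hvw). auto.
Qed.

Lemma end_map_side_decreasing x n :
  incl (side (Nat.iter n f x) (f (Nat.iter n f x))) (side x (f x)).
Proof.
  induction n as [|n IH]; [now intros y|].
  intros y Hy. apply IH. revert y Hy. apply (side_incl_next adj tree); try apply end_map_adj.
  apply Hf.
Qed.

Lemma end_map_lower_bound v1 v2 : exists v,
  incl (side v (f v)) (side v1 (f v1)) /\ incl (side v (f v)) (side v2 (f v2)).
Proof.
  destruct (end_map_merge v1 v2) as (i & j & E). exists (Nat.iter i f v1).
  split; [|rewrite E]; apply end_map_side_decreasing.
Qed.

(** Otherwise the half-tree toward the end from [z] would lie beyond [u], disjoint from the one
    toward it from [x]. *)
Lemma end_map_toward x z u :
  adj x u -> f x <> u -> side x u z -> side z (f z) x.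
Proof.
  intros Hxu Hne Hz. pose proof (end_map_adj z) as Hzf. apply NNPP. intros Hx.
  apply (end_map_meet z x). assert (H : incl (side z (f z)) (side x u)).
  { apply side_incl; [|exact Hx]. apply side_step with z; auto.
    intros [_ E]. apply Hx. rewrite E. constructor. }
  intros y Hy. apply (side_disj_fork adj tree x u (f x)); auto using end_map_adj.
Qed.

Lemma iter_end_map_is_ray x : is_ray V adj (fun n => Nat.iter n f x).
Proof. intros n. split; [apply end_map_adj|]. apply Hf. Qed.

Lemma iter_end_map_equiv x y :
  ray_equiv V (fun n => Nat.iter n f x) (fun n => Nat.iter n f y).
Proof. exact (iter_end_map_merge x y). Qed.
End EndMap.

Lemma end_map_unique f f' x y : end_map f -> end_map f' ->
  ray_equiv V (fun n => Nat.iter n f x) (fun n => Nat.iter n f' y) ->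
  forall z, f z = f' z.
Proof.
  intros Hf Hf' (i & j & E) z.
  assert (Htail : forall n, f (Nat.iter (i + n) f x) = f' (Nat.iter (i + n) f x)).
  { intros n. rewrite (E n) at 2.
    change (Nat.iter (S (i + n)) f x = Nat.iter (S (j + n)) f' y).
    rewrite <- !Nat.add_succ_r. apply E. }
  destruct (iter_end_map_merge f Hf z x) as (k & m & Ekm).
  assert (Hk : f (Nat.iter (k + i) f z) = f' (Nat.iter (k + i) f z)).
  { rewrite Ekm, (Nat.add_comm m i). apply Htail. }
  revert Hk. generalize (k + i)%nat as n. clear - Hf Hf'.
  induction n as [|n IH]; [auto|]. intros H. apply IH. clear IH.
  simpl in H. set (a := Nat.iter n f z) in *.
  (* Agreement is pulled back from [f a] to [a]: the alternative [f' (f a) = a] would make [f]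
     backtrack. *)
  destruct (proj2 (proj2 Hf') a (f a) (proj1 Hf a)) as [E|E]; [auto|].
  exfalso. apply (proj1 (proj2 Hf) a). congruence.
Qed.

(** * Equivalence of rays and the action of automorphisms on ends *)

Lemma ray_equiv_sym r r' : ray_equiv V r r' -> ray_equiv V r' r.
Proof. intros (i & j & H). exists j, i. auto. Qed.

Lemma ray_equiv_trans r r' r'' :
  ray_equiv V r r' -> ray_equiv V r' r'' -> ray_equiv V r r''.
Proof.
  intros (i & j & H) (k & l & H'). exists (i + k)%nat, (l + j)%nat. intros n.
  rewrite <- Nat.add_assoc, H, (Nat.add_assoc j), (Nat.add_comm j k), <- !Nat.add_assoc.
  apply H'.
Qed.

Lemma ray_equiv_map (g : V -> V) r r' :
  ray_equiv V r r' -> ray_equiv V (fun n => g (r n)) (fun n => g (r' n)).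
Proof. intros (i & j & H). exists i, j. intros n. now rewrite H. Qed.

Lemma end_map_conj f g g' : is_automorphism V adj g ->
  (forall x, g (g' x) = x) -> (forall x, g' (g x) = x) ->
  end_map f -> end_map (fun x => g (f (g' x))).
Proof.
  intros (Hadj & Hinj & _) E E' (F1 & F2 & F3). repeat split.
  - intros v. rewrite <- (E v) at 1. now apply (proj1 (Hadj _ _)).
  - intros v H. apply (F2 (g' v)). rewrite E' in H. apply Hinj. now rewrite E.
  - intros v w Hvw. rewrite <- (E v), <- (E w) in Hvw.
    apply (proj2 (Hadj _ _)) in Hvw.
    destruct (F3 _ _ Hvw) as [H|H]; [left|right]; rewrite H; apply E.
Qed.

Lemma iter_conj (f g g' : V -> V) n x : (forall x, g' (g x) = x) ->
  Nat.iter n (fun x => g (f (g' x))) (g x) = g (Nat.iter n f x).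
Proof. intros E. induction n as [|n IH]; [reflexivity|]. simpl. now rewrite IH, E. Qed.

(** [g] carries the end of [f] to the end of its conjugate by [g], and an end determines its end
    map. *)
Lemma end_map_fixed_iff f g g' x : is_automorphism V adj g ->
  (forall x, g (g' x) = x) -> (forall x, g' (g x) = x) -> end_map f ->
  (fixes_end V g (fun n => Nat.iter n f x) <-> forall v, f (g v) = g (f v)).
Proof.
  intros Hg E E' Hf. pose proof (end_map_conj f g g' Hg E E' Hf) as Hc. split.
  - intros H v. rewrite <- (E' v) at 2. symmetry.
    apply (end_map_unique _ f (g x) x Hc Hf).
    destruct H as (i & j & H). exists i, j. intros n. rewrite iter_conj by auto. apply H.
  - intros H. destruct (iter_end_map_merge f Hf (g x) x) as (i & j & Hij).
    exists i, j. intros n. rewrite <- Hij. generalize (i + n)%nat as m.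
    induction m as [|m IH]; [reflexivity|]. simpl. now rewrite <- IH, H.
Qed.

(** * Existence of ends in a tree without leaves *)

Section NoLeaf.
Hypothesis no_leaf : forall p q, adj p q -> exists r, adj q r /\ r <> p.

(** A ray is chosen edge by edge; the half-trees containing some half-tree of this ray form a filter
    with a direction at every vertex. *)
Lemma end_map_exists p q : adj p q -> exists f, end_map f /\ f p = q.
Proof.
  intros Hpq.
  assert (Hnext : forall p q, exists r, adj p q -> adj q r /\ r <> p).
  { intros a b. destruct (classic (adj a b)) as [H|H].
    - destruct (no_leaf a b H) as [r Hr]. eauto.
    - exists a. tauto. }
  set (next := fun a b => proj1_sig (constructive_indefinite_description _ (Hnext a b))).
  assert (next_spec : forall a b, adj a b -> adj b (next a b) /\ next a b <> a).
  { intros a b. unfold next.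
    now destruct (constructive_indefinite_description _ (Hnext a b)). }
  set (r := fun n => Nat.iter n (fun e : V * V => (snd e, next (fst e) (snd e))) (p, q)).
  assert (Hr : forall n, adj (fst (r n)) (snd (r n))).
  { induction n as [|n IH]; [exact Hpq|]. simpl. now apply next_spec. }
  assert (Hdec : forall n,
            incl (side (fst (r (S n))) (snd (r (S n)))) (side (fst (r n)) (snd (r n)))).
  { intros n. simpl. apply side_incl_next; auto; now apply next_spec. }
  assert (Hdec' : forall n k,
            incl (side (fst (r (n + k)%nat)) (snd (r (n + k)%nat))) (side (fst (r n)) (snd (r n)))).
  { intros n k. induction k as [|k IH].
    - rewrite Nat.add_0_r. now intros x.
    - rewrite Nat.add_succ_r. intros x Hx. apply IH, Hdec, Hx. }
  (* A walk of [n] edges can undo at most [n] steps of the ray; hence every vertex is outside some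
     half-tree of the ray. *)
  assert (Hfar : forall n k x z, within n x z ->
            side (fst (r (n + k)%nat)) (snd (r (n + k)%nat)) z -> side (fst (r k)) (snd (r k)) x).
  { intros n k x z H. revert k. induction H as [x|n x y z H IH Hyz]; intros k Hz; [exact Hz|].
    apply IH.
    destruct (classic (side (fst (r (S (n + k)))) (snd (r (S (n + k)))) y)) as [Hy|Hy].
    - now apply Hdec.
    - destruct (side_cross adj _ _ _ _ Hz (adj_sym adj tree _ _ Hyz) Hy) as [_ ->].
      simpl. constructor. }
  set (M := fun a b => adj a b /\ exists n, incl (side (fst (r n)) (snd (r n))) (side a b)).
  assert (HM : half_tree_filter M).
  { repeat split.
    - now intros a b [].
    - assumption.
    - destruct H0 as [_ [n Hn]]. exists n. intros x Hx. auto.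
    - intros a b a' b' [_ [n Hn]] [_ [n' Hn']] D.
      apply (D (snd (r (n + n')%nat))).
      + apply Hn, (Hdec' n n'). constructor.
      + apply Hn', (Hdec' n' n). rewrite (Nat.add_comm n' n). constructor. }
  destruct (filter_end M HM) as (f & Hf & HMf).
  - intros v. destruct (within_exists adj tree p v) as [n Hn].
    apply (filter_toward M v (fst (r n)) (snd (r n)) HM).
    + split; [apply Hr|]. exists n. now intros x.
    + intros Hv. rewrite <- (Nat.add_0_r n) in Hv. apply (Hfar n O p v Hn) in Hv.
      exact (side_root adj tree p q Hpq Hv).
  - exists f. split; [exact Hf|]. apply HMf. split; [exact Hpq|]. exists O. now intros x.
Qed.
End NoLeaf.

End Ends.

(** * Dynamics of a group acting on the tree *)

Section Dynamics.
Context {V : Type}.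
Variable adj : V -> V -> Prop.
Hypothesis tree : is_simplicial_tree V adj.

Notation side := (side adj).
Notation within := (within adj).
Notation end_map := (end_map adj).

Definition dynamic (K : (V -> V) -> Prop) : Prop :=
  forall v w p q, adj v w -> adj p q ->
    exists k, K k /\ forall x, side v w x -> side p q (k x).

Definition coreless (K : (V -> V) -> Prop) : Prop :=
  forall p q (S : V -> Prop), adj p q -> (exists s, S s) -> incl S (side p q) ->
    (forall g s, K g -> S s -> S (g s)) -> False.

(** Commuting with the end map amounts to fixing the end. *)
Definition endless (K : (V -> V) -> Prop) : Prop :=
  forall f, end_map f -> (forall g v, K g -> f (g v) = g (f v)) -> False.

(** Some translate of the edge has one of its two half-trees inside the target; if it is the wrong
    one, the half-tree is first moved into its complement. *)
Lemma coreless_endless_dynamic K :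
  is_aut_subgroup V adj K -> coreless K -> endless K -> dynamic K.
Proof.
  intros HK Hcore Hend. pose proof HK as (Kaut & K1 & Kmul & Kinv).
  assert (Hone : forall v w p q, adj v w -> adj p q -> exists k, K k /\
            ((forall x, side v w x -> side p q (k x)) \/
             (forall x, side w v x -> side p q (k x)))).
  { intros v w p q Hvw Hpq.
    (* Otherwise the orbit of [v] would be an invariant set inside [side q p]. *)
    assert (Hk : exists k, K k /\ side p q (k v)).
    { apply NNPP. intros H.
      apply (Hcore q p (fun x => exists k, K k /\ x = k v)).
      - now apply (adj_sym adj tree).
      - exists v. exists (fun x => x). auto.
      - intros x (k & Hk & ->). apply (side_compl adj tree); auto.
        intros Hs. apply H. eauto.
      - intros g x Hg (k & Hk & ->). exists (fun y => g (k y)). auto. }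
    destruct Hk as (k & Hk & Hv). exists k. split; [exact Hk|].
    pose proof (Kaut k Hk) as Ak.
    assert (Hmap : forall a b, incl (side (k a) (k b)) (side p q) ->
              forall x, side a b x -> side p q (k x)).
    { intros a b Hi x Hx. apply Hi. now apply side_automorphism. }
    assert (Hkvw : adj (k v) (k w)) by now apply (proj1 (proj1 Ak _ _)).
    destruct (classic (side p q (k w))) as [Hw|Hw].
    - destruct (classic (side (k w) (k v) p)) as [Hp|Hp].
      + left. apply Hmap. apply side_incl; [exact Hw|].
        rewrite <- (side_compl adj tree); auto.
      + right. apply Hmap. now apply side_incl.
    - destruct (side_cross adj _ _ _ _ Hv Hkvw Hw) as [E1 E2].
      right. apply Hmap. rewrite E1, E2. now intros x. }
  assert (Hflip : forall v w, adj v w -> exists k, K k /\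
            forall x, side v w x -> side w v (k x)).
  { intros v w Hvw. apply NNPP. intros Hno.
    (* Without a flip no two translates of [side v w] are disjoint, so the half-trees containing a
       translate form an invariant filter. *)
    set (M := fun p q => adj p q /\ exists k, K k /\ forall x, side v w x -> side p q (k x)).
    assert (HM : half_tree_filter adj M).
    { split; [|split].
      - now intros p q [].
      - intros p q p' q' Hpq' [Hpq (k & Hk & H)] Hi. split; [exact Hpq'|].
        exists k. split; [exact Hk|]. intros x Hx. apply Hi. auto.
      - intros p q p' q' [Hpq (k & Hk & H)] [Hpq' (k' & Hk' & H')] D. apply Hno.
        destruct (Kinv k' Hk') as (i & Hi & E & _).
        exists (fun x => i (k x)). split; [auto|]. intros x Hx.
        apply (side_compl adj tree); [exact Hvw|]. intros Hs.
        apply (D (k x)); [auto|]. rewrite <- (E (k x)). auto. }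
    destruct (invariant_filter_end_or_core adj tree K M v w HK HM)
      as [(f & Hf & _ & Hinv)|(S & Hne & Hi & Hinv)].
    - intros g p q Hg [Hpq (k & Hk & H)]. split.
      + now apply (proj1 (proj1 (Kaut g Hg) _ _)).
      + exists (fun x => g (k x)). split; [auto|]. intros x Hx.
        apply side_automorphism; auto.
    - split; [exact Hvw|]. exists (fun x => x). auto.
    - exact (Hend f Hf Hinv).
    - exact (Hcore v w S Hvw Hne Hi Hinv). }
  intros v w p q Hvw Hpq. destruct (Hone v w p q Hvw Hpq) as (k & Hk & [H|H]); [eauto|].
  destruct (Hflip v w Hvw) as (k' & Hk' & H').
  exists (fun x => k (k' x)). split; auto.
Qed.

(* The double coset condition makes all pairs of distinct [K]-translates of a
   [P]-invariant set equidistant, while [K] moves half-trees arbitrarily far apart. *)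
Lemma two_cosets_coreless (K P : (V -> V) -> Prop) g1 :
  (forall p q, adj p q -> exists r, adj q r /\ r <> p) ->
  (forall g, K g -> is_automorphism V adj g) -> dynamic K ->
  (forall g, P g -> K g) -> K g1 -> ~ P g1 ->
  (forall g, K g -> ~ P g ->
     exists k k', P k /\ P k' /\ forall x, k (g1 x) = g (k' x)) ->
  coreless P.
Proof.
  intros no_leaf Kaut Hdyn HPK Kg1 Pg1 Hcos p q S Hpq [s Hs] Hi Hinv.
  destruct (within_exists adj tree s (g1 s)) as [n Hn].
  destruct (half_tree_far adj tree no_leaf p q n Hpq) as (p' & q' & Hpq' & Hi' & Hfar).
  destruct (Hdyn p q p' q' Hpq Hpq') as (g2 & Kg2 & H2).
  assert (Hdis : forall x, S x -> ~ side q p x).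
  { intros x Hx H. apply (side_disj adj tree p q Hpq x); auto. }
  assert (Pg2 : ~ P g2).
  { intros Pg2. apply (Hdis (g2 s)); auto. }
  destruct (Hcos g2 Kg2 Pg2) as (k & k' & Pk & Pk' & E).
  (* The walk from [k s] to [k (g1 s) = g2 (k' s)] has length [n] and ends in the far half-tree. *)
  apply (Hdis (k s)); [auto|]. apply (Hfar (k s) (k (g1 s))).
  - apply within_automorphism; auto.
  - rewrite E. auto.
Qed.

(** * Convexity of half-trees *)

Lemma reduced_walk_no_return p n i j : is_reduced_walk V adj p n ->
  (i < j)%nat -> (j <= n)%nat -> p i <> p j.
Proof.
  intros [Hw Hr] Hij Hj. destruct tree as (_ & _ & _ & acyclic).
  specialize (acyclic (fun m => p (i + m)%nat) (j - i)%nat).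
  simpl in acyclic. rewrite Nat.add_0_r in acyclic.
  replace (i + (j - i))%nat with j in acyclic by lia. apply acyclic; [lia|]. split.
  - intros m Hm. simpl. rewrite Nat.add_succ_r. apply Hw. lia.
  - intros m Hm. simpl. rewrite !Nat.add_succ_r. apply Hr. lia.
Qed.

Lemma last_before (P : nat -> Prop) i j : (i <= j)%nat -> P i -> ~ P j ->
  exists k, (i <= k < j)%nat /\ P k /\ ~ P (S k).
Proof.
  intros Hij Hi Hj. induction Hij as [|j Hij IH]; [tauto|].
  destruct (classic (P j)) as [H|H].
  - exists j. split; [lia|auto].
  - destruct (IH H) as (k & Hk & H'). exists k. split; [lia|exact H'].
Qed.

(** Leaving the half-tree and returning both use its boundary edge, so a reduced walk doing this
    would visit [b] twice. *)
Lemma side_convex a b p n : adj a b -> is_reduced_walk V adj p n ->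
  side a b (p O) -> side a b (p n) -> forall i, (i <= n)%nat -> side a b (p i).
Proof.
  intros Hab Hp H0 Hn i Hi. apply NNPP. intros Hs. pose proof Hp as [Hw _].
  destruct (last_before (fun m => side a b (p m)) O i) as (j & Hj & Hj1 & Hj2); auto; [lia|].
  destruct (last_before (fun m => ~ side a b (p m)) i n) as (k & Hk & Hk1 & Hk2); auto.
  apply NNPP in Hk2.
  destruct (side_cross adj a b (p j) (p (S j))) as [E1 _]; auto; [apply Hw; lia|].
  destruct (side_cross adj a b (p (S k)) (p k)) as [E2 _]; auto.
  { apply (adj_sym adj tree). apply Hw. lia. }
  apply (reduced_walk_no_return p n j (S k)); auto; [lia|lia|congruence].
Qed.

(** * Consequences of minimality and general type *)

Section MinimalGeneralType.
Variable G : (V -> V) -> Prop.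
Hypothesis HG : is_aut_subgroup V adj G.

(** The vertices whose whole orbit lies in [side p q] form an invariant subtree, half-trees being
    convex; by minimality it would contain [p]. *)
Lemma minimal_coreless : minimal_action V adj G -> coreless G.
Proof.
  intros Hmin p q S Hpq [s Hs] Hi Hinv. pose proof HG as (Gaut & G1 & Gmul & Ginv).
  enough (H : forall v g, G g -> side p q (g v)).
  { apply (side_root adj tree p q Hpq). apply (H p (fun x => x)). exact G1. }
  apply (Hmin (fun v => forall g, G g -> side p q (g v))).
  - split; [exists s; auto|]. intros x y Hx Hy.
    assert (Hp : exists r n, r O = x /\ r n = y /\ is_reduced_walk V adj r n).
    { destruct (classic (x = y)) as [<-|Hne].
      - exists (fun _ => x), O. repeat split; auto; intros i Hlt; lia.
      - destruct (side_direction adj tree x y Hne) as (w & Hw & Hyw).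
        destruct (side_reduced_walk adj x w y Hw Hyw)
          as (r & n & _ & H0 & _ & Hn & Hr). eauto. }
    destruct Hp as (r & n & H0 & Hn & Hr). exists r, n.
    repeat split; auto; [apply Hr|]. intros i Hle g Hg.
    destruct (Gaut g Hg) as (Hadj & Hinj & _).
    apply (side_convex p q (fun m => g (r m)) n); auto; try congruence.
    + destruct Hr as [Hw Hr]. split.
      * intros m Hm. apply (proj1 (Hadj _ _)). auto.
      * intros m Hm E. apply (Hr m Hm). auto.
    + rewrite H0. auto.
    + rewrite Hn. auto.
  - intros g v Hg Hv h Hh. apply (Hv (fun x => h (g x))). auto.
Qed.

(** If [f] moves forward at one place of the axis, it does so at all earlier places, having one
    value at each vertex, and at all translates by [g]: hence everywhere. *)
Lemma axis_fixed_end f g l : end_map f -> (forall v, f (g v) = g (f v)) ->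
  hyperbolic_with_axis V adj g l ->
  (forall k, f (l k) = l (k + 1)) \/ (forall k, f (l (k + 1)) = l k).
Proof.
  intros Hf Hg [Hl (t & Ht & Hgl)].
  assert (Hor : forall k, f (l k) = l (k + 1) \/ f (l (k + 1)) = l k).
  { intros k. apply (end_map_or adj f Hf), Hl. }
  assert (Hback : forall k, f (l (k + 1)) = l (k + 1 + 1) -> f (l k) = l (k + 1)).
  { intros k E. destruct (Hor k) as [H|H]; [exact H|].
    exfalso. apply (proj2 (Hl k)). replace (k + 2) with (k + 1 + 1) by lia. congruence. }
  assert (Hbacks : forall n k, f (l (k + Z.of_nat n)) = l (k + Z.of_nat n + 1) ->
            f (l k) = l (k + 1)).
  { induction n as [|n IH]; intros k E.
    - now rewrite Z.add_0_r in E.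
    - apply Hback. apply IH.
      replace (k + 1 + Z.of_nat n) with (k + Z.of_nat (S n)) by lia. exact E. }
  assert (Hshift : forall n k, f (l k) = l (k + 1) ->
            f (l (k + Z.of_nat n * t)) = l (k + Z.of_nat n * t + 1)).
  { induction n as [|n IH]; intros k E.
    - now replace (k + Z.of_nat 0 * t) with k by lia.
    - replace (k + Z.of_nat (S n) * t) with (k + t + Z.of_nat n * t) by lia. apply IH.
      rewrite <- Hgl, Hg, E, Hgl. f_equal. lia. }
  destruct (classic (exists k, f (l k) = l (k + 1))) as [[k0 H0]|Hno].
  (* This number of steps leads from [k] to a translate of [k0] at or beyond [k]. *)
  - left. intros k. apply (Hbacks (Z.to_nat (k0 + Z.abs (k - k0) * t - k))).
    assert (E : k + Z.of_nat (Z.to_nat (k0 + Z.abs (k - k0) * t - k)) =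
                k0 + Z.of_nat (Z.abs_nat (k - k0)) * t).
    { rewrite Zabs2Nat.id_abs, Z2Nat.id; [lia|]. nia. }
    rewrite E. now apply Hshift.
  - right. intros k. destruct (Hor k) as [H|H]; [|exact H]. exfalso. eauto.
Qed.

Lemma axis_end_is_endpoint f g l : end_map f -> (forall v, f (g v) = g (f v)) ->
  hyperbolic_with_axis V adj g l ->
  ray_equiv V (plus_end V l) (fun n => Nat.iter n f (l 0)) \/
  ray_equiv V (minus_end V l) (fun n => Nat.iter n f (l 0)).
Proof.
  intros Hf Hg Hl. destruct (axis_fixed_end f g l Hf Hg Hl) as [H|H]; [left|right];
    exists O, O; intros n; simpl; [unfold plus_end|unfold minus_end];
    induction n as [|n IH]; simpl Nat.iter; auto; rewrite <- IH.
  - rewrite H. f_equal. lia.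
  - rewrite <- (H (- Z.of_nat (S n))). do 2 f_equal. lia.
Qed.

(** A fixed end would be an endpoint of both axes. *)
Lemma general_type_endless : general_type V adj G -> endless G.
Proof.
  intros (g & h & l1 & l2 & Hg & Hh & H1 & H2 & Hno) f Hf Hinv. apply Hno.
  assert (E : ray_equiv V (fun n => Nat.iter n f (l1 0)) (fun n => Nat.iter n f (l2 0)))
    by now apply iter_end_map_equiv with adj.
  unfold common_endpoint.
  destruct (axis_end_is_endpoint f g l1 Hf) as [E1|E1]; auto;
  destruct (axis_end_is_endpoint f h l2 Hf) as [E2|E2]; auto;
  pose proof (ray_equiv_trans _ _ _ (ray_equiv_trans _ _ _ E1 E) (ray_equiv_sym _ _ E2)); auto.
Qed.

(** Without a branch vertex the tree is the first axis alone, and the second axis runs along it in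
    one of two directions, sharing an endpoint. *)
Lemma general_type_branch : general_type V adj G ->
  exists x y1 y2 y3, adj x y1 /\ adj x y2 /\ adj x y3 /\ y1 <> y2 /\ y1 <> y3 /\ y2 <> y3.
Proof.
  intros (g & h & l1 & l2 & _ & _ & [H1 _] & [H2 _] & Hno). apply NNPP. intros Hb. apply Hno.
  assert (Hnbr : forall k y, adj (l1 k) y -> y = l1 (k + 1) \/ y = l1 (k - 1)).
  { intros k y Hy. apply NNPP. intros Hn. apply Hb.
    exists (l1 k), (l1 (k + 1)), (l1 (k - 1)), y.
    assert (Hk : adj (l1 (k - 1)) (l1 k))
      by (replace k with (k - 1 + 1) at 2 by lia; apply H1).
    assert (Hk' : l1 (k + 1) <> l1 (k - 1))
      by (replace (k + 1) with (k - 1 + 2) by lia; apply H1).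
    repeat split; auto; [apply H1|now apply (adj_sym adj tree)]. }
  assert (Hall : forall x, exists k, x = l1 k).
  { apply (tree_ind adj tree (l1 0)); [eauto|].
    intros y z Hyz [k ->]. destruct (Hnbr k z Hyz); eauto. }
  destruct (Hall (l2 0)) as [k Hk].
  assert (Hdir : exists s, (s = 1 \/ s = -1) /\ forall n : nat, l2 (Z.of_nat n) = l1 (k + s * Z.of_nat n)).
  { assert (Hs : exists s, (s = 1 \/ s = -1) /\ l2 1 = l1 (k + s)).
    { destruct (Hnbr k (l2 1)) as [E|E].
      - rewrite <- Hk. apply (H2 0).
      - exists 1. auto.
      - exists (-1). auto. }
    destruct Hs as (s & Hs & E). exists s. split; [exact Hs|].
    enough (H : forall n : nat, l2 (Z.of_nat n) = l1 (k + s * Z.of_nat n) /\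
                  l2 (Z.of_nat (S n)) = l1 (k + s * Z.of_nat (S n))) by apply H.
    induction n as [|n [IH1 IH2]].
    - split; [change (l2 0 = l1 (k + s * 0)); rewrite Hk|change (l2 1 = l1 (k + s * 1)); rewrite E]; f_equal; lia.
    - split; [exact IH2|].
      destruct (H2 (Z.of_nat n)) as [_ Hne].
      destruct (H2 (Z.of_nat (S n))) as [Hadj _].
      replace (Z.of_nat n + 2) with (Z.of_nat (S (S n))) in Hne by lia.
      replace (Z.of_nat (S n) + 1) with (Z.of_nat (S (S n))) in Hadj by lia.
      rewrite IH2 in Hadj. rewrite IH1 in Hne.
      destruct (Hnbr _ _ Hadj) as [E'|E']; rewrite E' in Hne |- *; destruct Hs as [-> | ->];
        try (f_equal; lia); exfalso; apply Hne; f_equal; lia. }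
  destruct Hdir as (s & [-> | ->] & Hs).
  (* The summand [Z.abs k] keeps both starting indices non-negative. *)
  - left. exists (Z.to_nat (Z.abs k + k)), (Z.to_nat (Z.abs k)).
    intros n. unfold plus_end. rewrite Hs. f_equal. lia.
  - right; right; left. exists (Z.to_nat (Z.abs k - k)), (Z.to_nat (Z.abs k)).
    intros n. unfold plus_end, minus_end. rewrite Hs. f_equal. lia.
Qed.

(** [side y1 x] contains the two vertices [x] and [y2], so its image gives [side p q] a vertex other
    than [q]. *)
Lemma dynamic_branch_no_leaf x y1 y2 : dynamic G -> adj x y1 -> adj x y2 -> y1 <> y2 ->
  forall p q, adj p q -> exists r, adj q r /\ r <> p.
Proof.
  intros Hdyn A1 A2 Hne p q Hpq.
  destruct (Hdyn y1 x p q) as (k & Hk & H); auto; [now apply (adj_sym adj tree)|].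
  assert (Hz : exists z, side p q z /\ q <> z).
  { destruct (classic (q = k x)) as [->|Hx].
    - exists (k y2). split.
      + apply H. apply side_step with x; auto; [constructor|]. intros [_ E]. auto.
      + intros E. destruct HG as (Gaut & _). apply (Gaut k Hk) in E. subst.
        exact (adj_irrefl adj tree _ A2).
    - exists (k x). split; [apply H; constructor|exact Hx]. }
  destruct Hz as (z & Hz & Hqz).
  destruct (side_direction adj tree q z Hqz) as (r & Hqr & Hr). exists r. split; [exact Hqr|].
  intros ->. exact (side_disj adj tree p q Hpq z Hz Hr).
Qed.

(** * Non-trivial elements supported in a half-tree *)

Section Rigid.
Variables x0 y1 y2 y3 : V.
Hypothesis branch : adj x0 y1 /\ adj x0 y2 /\ adj x0 y3 /\ y1 <> y2 /\ y1 <> y3 /\ y2 <> y3.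
Hypothesis Hdyn : dynamic G.

Let no_leaf : forall p q, adj p q -> exists r, adj q r /\ r <> p.
Proof. destruct branch as (A1 & A2 & _ & Hne & _). now apply (dynamic_branch_no_leaf x0 y1 y2). Qed.

(* The vertex at which three fixed ends meet is fixed. *)
Lemma fixed_ends_fixed_half_tree v w g : adj v w -> G g ->
  (forall f, end_map f -> f v = w -> forall z, f (g z) = g (f z)) ->
  exists x y, adj x y /\ forall z, side x y z -> g z = z.
Proof.
  intros Hvw Hg Hfix. pose proof HG as (Gaut & G1 & Gmul & Ginv).
  destruct branch as (A1 & A2 & A3 & N12 & N13 & N23).
  (* Every half-tree contains two of the half-trees branching from some translate of [x0]. *)
  assert (Himg : forall p q, adj p q -> exists x u1 u2 u3, adj x u1 /\ adj x u2 /\ adj x u3 /\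
            u1 <> u2 /\ u1 <> u3 /\ u2 <> u3 /\
            incl (side x u2) (side p q) /\ incl (side x u3) (side p q)).
  { intros p q Hpq. destruct (Hdyn y1 x0 p q) as (k & Hk & H); auto;
      [now apply (adj_sym adj tree)|].
    destruct (Gaut k Hk) as (Hadj & Hinj & _).
    exists (k x0), (k y1), (k y2), (k y3).
    repeat split; try (apply (proj1 (Hadj _ _))); auto.
    - apply (side_image adj tree k); auto.
      intros z Hz. apply H. revert z Hz. apply side_incl_next; auto.
      now apply (adj_sym adj tree).
    - apply (side_image adj tree k); auto.
      intros z Hz. apply H. revert z Hz. apply side_incl_next; auto.
      now apply (adj_sym adj tree). }
  destruct (Himg v w Hvw) as (x & _ & u2 & u3 & _ & B2 & B3 & _ & _ & M23 & I2 & I3).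
  destruct (Himg x u2 B2) as (y & _ & t2 & t3 & _ & C2 & C3 & _ & _ & L23 & J2 & J3).
  clear Himg.
  (* The three ends lie in [side v w] and leave [y] in different directions. *)
  destruct (end_map_exists adj tree no_leaf x u3 B3) as (f1 & F1 & E1).
  destruct (end_map_exists adj tree no_leaf y t2 C2) as (f2 & F2 & E2).
  destruct (end_map_exists adj tree no_leaf y t3 C3) as (f3 & F3 & E3).
  assert (N2 : f1 y <> t2).
  { intros E. apply M23. rewrite <- E1. symmetry.
    apply (end_map_up adj tree f1 F1 x u2 y B2). now rewrite E. }
  assert (N3 : f1 y <> t3).
  { intros E. apply M23. rewrite <- E1. symmetry.
    apply (end_map_up adj tree f1 F1 x u2 y B2). now rewrite E. }
  assert (W1 : f1 v = w).
  { apply (end_map_up adj tree f1 F1 v w x Hvw). now rewrite E1. }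
  assert (W2 : f2 v = w).
  { apply (end_map_up adj tree f2 F2 v w y Hvw). rewrite E2. intros z Hz. auto. }
  assert (W3 : f3 v = w).
  { apply (end_map_up adj tree f3 F3 v w y Hvw). rewrite E3. intros z Hz. auto. }
  destruct (Gaut g Hg) as (Hadj & Hinj & _).
  assert (Hy : g y = y).
  (* If [y] moved, then for every end not directed from [y] toward [g y] the map [g] would send its
     direction at [y] to the one leading back to [y]; this holds for two of the three ends, against
     injectivity. *)
  { apply NNPP. intros Hne.
    destruct (side_direction adj tree y (g y)) as (u & Hu & Hgy); [congruence|].
    destruct (side_direction adj tree (g y) y Hne) as (u' & Hu' & Hgy').
    assert (Hdir : forall f, end_map f -> f v = w -> f y <> u -> g (f y) = u').
    { intros f Hf Hfw Hfu. rewrite <- Hfix by auto.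
      apply (side_direction_unique adj tree (g y) _ _ y); auto.
      - exact (end_map_adj adj f Hf _).
      - apply (end_map_toward adj tree f Hf y (g y) u); auto. }
    assert (Htwo : forall f f', end_map f -> end_map f' -> f v = w -> f' v = w ->
              f y <> f' y -> f y <> u -> f' y <> u -> False).
    { intros f f' Hf Hf' Hw Hw' Hd Hfu Hfu'. apply Hd, Hinj.
      rewrite (Hdir f), (Hdir f'); auto. }
    destruct (classic (f1 y = u)) as [<-|K1].
    - apply (Htwo f2 f3); congruence.
    - destruct (classic (f2 y = u)) as [<-|K2].
      + apply (Htwo f1 f3); congruence.
      + apply (Htwo f1 f2); congruence. }
  exists y, t2. split; [exact C2|].
  intros z Hz. induction Hz as [|z z' Hz IH Hzz' Hne].
  - rewrite <- E2, <- (Hfix f2 F2 W2), Hy. reflexivity.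
  (* The next vertex either leads back to the fixed vertex [y] or is the direction of a fixed
     end. *)
  - destruct (classic (side z z' y)) as [H|H].
    + symmetry. apply (side_direction_unique adj tree z z' (g z') y); auto.
      * rewrite <- IH at 1. now apply (proj1 (Hadj _ _)).
      * rewrite <- IH, <- Hy. apply side_automorphism; auto.
    + destruct (end_map_exists adj tree no_leaf z z' Hzz') as (f & F & E).
      assert (W : f v = w).
      { apply (end_map_up adj tree f F v w z Hvw). rewrite E.
        assert (Hi : incl (side z z') (side y t2)).
        { apply side_incl; [|exact H]. now apply side_step with z. }
        intros a Ha. auto. }
      rewrite <- E, <- (Hfix f F W), IH. reflexivity.
Qed.

(** A non-empty open set of fixed ends contains a shadow, and an end map sending [v] to [w]
    represents an end of that shadow. *)
Lemma not_topologically_free_fixed_ends : ~ topologically_free V adj G ->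
  exists v w g, adj v w /\ G g /\ (exists x, g x <> x) /\
    forall f, end_map f -> f v = w -> forall z, f (g z) = g (f z).
Proof.
  intros Hntf. pose proof HG as (Gaut & G1 & Gmul & Ginv).
  apply NNPP. intros Hno. apply Hntf. intros g Hg Hmove U Hopen HU r Hr Ur. apply Hno.
  destruct (Hopen r Hr Ur) as (v & w & Hvw & _ & Hsub).
  exists v, w, g. repeat split; auto. intros f Hf Hw.
  destruct (Ginv g Hg) as (g' & _ & E & E').
  apply (end_map_fixed_iff adj tree f g g' v (Gaut g Hg) E E' Hf).
  apply HU; [now apply iter_end_map_is_ray|].
  apply Hsub; [now apply iter_end_map_is_ray|].
  exists (fun n => Nat.iter n f v). repeat split; auto.
  - now apply iter_end_map_is_ray.
  - apply Hf.
  - exists O, O. reflexivity.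
Qed.

(** Some non-trivial [g] fixes a half-tree [side a b] pointwise; conjugating by an element that
    moves [side q p] into [side a b] makes it trivial on [side q p]. *)
Lemma rigid_nontrivial : ~ topologically_free V adj G ->
  forall p q, adj p q -> exists g, G g /\ (exists x, g x <> x) /\ supported (side p q) g.
Proof.
  intros Hntf p q Hpq. pose proof HG as (Gaut & G1 & Gmul & Ginv).
  destruct (not_topologically_free_fixed_ends Hntf) as (v & w & g & Hvw & Hg & [x Hx] & Hfix).
  destruct (fixed_ends_fixed_half_tree v w g Hvw Hg Hfix) as (a & b & Hab & Hgab).
  destruct (Hdyn q p a b) as (k & Hk & H); auto; [now apply (adj_sym adj tree)|].
  destruct (Ginv k Hk) as (k' & Hk' & E & E').
  exists (fun z => k' (g (k z))). repeat split; [auto|..].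
  - exists (k' x). rewrite E. intros F. apply Hx. apply (f_equal k) in F. now rewrite !E in F.
  - intros z Hz. rewrite Hgab; [apply E'|]. apply H.
    now apply (side_compl adj tree).
Qed.
End Rigid.
End MinimalGeneralType.
End Dynamics.

(** * Three-transitive actions *)

Section Actions.
Context {V Omega : Type}.
Variable adj : V -> V -> Prop.
Hypothesis tree : is_simplicial_tree V adj.
Variable G : (V -> V) -> Prop.
Hypothesis HG : is_aut_subgroup V adj G.
Variable act : (V -> V) -> Omega -> Omega.
Hypothesis Hact : is_action G act.
Hypothesis faithful : faithful_action G act.
Hypothesis three : three_transitive G act.

Notation side := (side adj).
Notation end_map := (end_map adj).

(** Membership in the rigid stabilizer in [G] of the half-tree [side p q]. *)
Definition rigid (p q : V) (g : V -> V) : Prop := G g /\ supported (side p q) g.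

Lemma G_aut g : G g -> is_automorphism V adj g.
Proof. apply HG. Qed.

Lemma G_comp g h : G g -> G h -> G (fun x => g (h x)).
Proof. apply HG. Qed.

Lemma act_comp g h w : G g -> G h -> act (fun x => g (h x)) w = act g (act h w).
Proof. apply Hact. Qed.

Lemma act_trivial g w : (forall x, g x = x) -> act g w = w.
Proof.
  intros E. replace g with (fun x : V => x) by (extensionality x; auto). apply Hact.
Qed.

Lemma G_inverse g : G g -> exists g', G g' /\
  (forall x, g (g' x) = x) /\ (forall x, g' (g x) = x) /\
  (forall w, act g (act g' w) = w) /\ (forall w, act g' (act g w) = w).
Proof.
  intros Hg. destruct HG as (_ & _ & _ & Ginv). destruct (Ginv g Hg) as (g' & Hg' & E & E').
  exists g'. repeat split; auto; intros w; rewrite <- act_comp by auto; now apply act_trivial.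
Qed.

Lemma act_inj g x y : G g -> act g x = act g y -> x = y.
Proof.
  intros Hg E. destruct (G_inverse g Hg) as (g' & _ & _ & _ & _ & F).
  rewrite <- (F x), <- (F y). now rewrite E.
Qed.

Lemma act_commute g h w : G g -> G h -> (forall x, g (h x) = h (g x)) ->
  act g (act h w) = act h (act g w).
Proof.
  intros Hg Hh E. rewrite <- !act_comp by auto. f_equal. now extensionality x.
Qed.

Lemma rigid_comp p q g h : rigid p q g -> rigid p q h -> rigid p q (fun x => g (h x)).
Proof. intros [Gg Sg] [Gh Sh]. split; [now apply G_comp|now apply supported_comp]. Qed.

Lemma rigid_mono p q p' q' g : incl (side p q) (side p' q') -> rigid p q g -> rigid p' q' g.
Proof. intros Hi [Gg Sg]. split; [exact Gg|]. now apply supported_mono with (side p q). Qed.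

Lemma rigid_inverse p q g g' : G g' -> (forall x, g' (g x) = x) -> rigid p q g -> rigid p q g'.
Proof. intros Gg' E [Gg Sg]. split; [exact Gg'|]. now apply supported_inverse with g. Qed.

Lemma rigid_transport p q p' q' k k' g : G k -> G k' -> (forall x, k (k' x) = x) ->
  (forall x, side p q x -> side p' q' (k x)) -> rigid p q g ->
  rigid p' q' (fun x => k (g (k' x))).
Proof.
  intros Gk Gk' E Hk [Gg Sg]. split.
  - apply (G_comp k (fun x => g (k' x))); [exact Gk|]. now apply G_comp.
  - intros x Hx. rewrite Sg; [apply E|]. intros H. apply Hx. rewrite <- E. auto.
Qed.

Lemma rigid_conj p q k k' g : G k -> G k' -> (forall x, k (k' x) = x) ->
  rigid p q g -> rigid (k p) (k q) (fun x => k (g (k' x))).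
Proof.
  intros Gk Gk' E. apply rigid_transport; auto. intros x Hx.
  apply side_automorphism; [now apply G_aut|exact Hx].
Qed.

Lemma act_conj k k' g w : G k -> G k' -> G g ->
  act (fun x => k (g (k' x))) w = act k (act g (act k' w)).
Proof.
  intros Gk Gk' Gg.
  etransitivity; [apply (act_comp k (fun x => g (k' x))); auto; now apply (G_comp g k')|].
  f_equal. now apply act_comp.
Qed.

Lemma rigid_commute p q p' q' g h w : disj (side p q) (side p' q') ->
  rigid p q g -> rigid p' q' h -> act g (act h w) = act h (act g w).
Proof.
  intros D [Gg Sg] [Gh Sh]. apply act_commute; auto.
  apply (supported_commute (side p q) (side p' q')); auto.
  - apply (G_aut g Gg).
  - apply (G_aut h Gh).
Qed.

Lemma stabilizer_subgroup K w : is_aut_subgroup V adj K -> (forall g, K g -> G g) ->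
  is_aut_subgroup V adj (fun g => K g /\ act g w = w).
Proof.
  intros (Kaut & K1 & Kmul & Kinv) HKG. split; [|split; [|split]].
  - intros g [Kg _]. now apply Kaut.
  - split; [exact K1|]. now apply act_trivial.
  - intros g h [Kg Hg] [Kh Hh]. split; [now apply Kmul|].
    rewrite act_comp by auto. congruence.
  - intros g [Kg Hg]. destruct (Kinv g Kg) as (g' & Kg' & E & E').
    exists g'. repeat split; auto. rewrite <- Hg at 1.
    rewrite <- act_comp by auto. now apply act_trivial.
Qed.

(** Turns transitivity of a stabilizer on points into a statement on its double cosets; the witness
    is [g2^-1 k g1]. *)
Lemma stabilizer_double_coset K w g1 g2 k : is_aut_subgroup V adj K ->
  (forall g, K g -> G g) -> K g1 -> K g2 -> K k ->
  act k (act g1 w) = act g2 w ->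
  exists k', (K k' /\ act k' w = w) /\ forall x, k (g1 x) = g2 (k' x).
Proof.
  intros (Kaut & K1 & Kmul & Kinv) HKG H1 H2 Hk E.
  destruct (Kinv g2 H2) as (g2' & H2' & F & F').
  exists (fun x => g2' (k (g1 x))). repeat split.
  - apply (Kmul g2' (fun x => k (g1 x))); auto.
  - rewrite (act_comp g2' (fun x => k (g1 x))); auto.
    rewrite (act_comp k g1), E by auto. rewrite <- act_comp by auto. now apply act_trivial.
  - intros x. now rewrite F.
Qed.

(** * Half-tree groups and multiple transitivity *)

Section Rigid.
Variables x0 y1 y2 y3 : V.
Hypothesis branch : adj x0 y1 /\ adj x0 y2 /\ adj x0 y3 /\ y1 <> y2 /\ y1 <> y3 /\ y2 <> y3.
Hypothesis Gdyn : dynamic adj G.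
Hypothesis rigid_ex : forall p q, adj p q -> exists g, G g /\ (exists x, g x <> x) /\ supported (side p q) g.

(** An involution [s] is corrected by a non-trivial [c] supported beyond an edge whose far vertex
    [s] moves: [s] carries that half-tree off itself, so the square of [s c] agrees with [c]
    there. *)
Lemma rigid_non_involution p q : adj p q ->
  exists a, rigid p q a /\ exists x, a (a x) <> x.
Proof.
  intros Hpq. destruct (rigid_ex p q Hpq) as (s & Gs & [x Hx] & Ss).
  destruct (classic (exists x, s (s x) <> x)) as [H|H]; [exists s; now repeat split|].
  assert (Hinvol : forall x, s (s x) = x) by (intros z; apply NNPP; eauto).
  destruct (G_aut s Gs) as (Hadj & Hinj & _).
  assert (Hp : s p = p) by (apply Ss; now apply side_root).
  assert (Hex : exists u y, adj u y /\ s u = u /\ s y <> y).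
  { apply NNPP. intros Hno. apply Hx. clear Hx. revert x. apply (tree_ind adj tree p); [exact Hp|].
    intros u y Huy Hu. apply NNPP. intros Hy. apply Hno. eauto. }
  destruct Hex as (u & y & Huy & Hu & Hy).
  assert (Husy : adj u (s y)) by (rewrite <- Hu; now apply (proj1 (Hadj _ _))).
  assert (Hi : incl (side u y) (side p q)).
  { apply side_incl.
    - apply NNPP. intros H'. auto.
    - intros H'. apply Hy. symmetry.
      apply (side_direction_unique adj tree u y (s y) p); auto.
      rewrite <- Hu, <- Hp. apply side_automorphism; [now apply G_aut|exact H']. }
  destruct (rigid_ex u y Huy) as (c & Gc & [z Hz] & Sc).
  exists (fun w => s (c w)). split.
  - split; [now apply G_comp|]. apply supported_comp; [exact Ss|].
    now apply supported_mono with (side u y).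
  - exists z. assert (Hcz : side u y (c z)).
    { apply NNPP. intros H'. apply Hz. destruct (G_aut c Gc) as (_ & cinj & _).
      apply cinj. now apply Sc. }
    rewrite (Sc (s (c z))); [now rewrite Hinvol|]. intros H'.
    apply (side_disj_fork adj tree u y (s y) Huy Husy) with (s (c z)); auto.
    rewrite <- Hu at 1. apply side_automorphism; [now apply G_aut|exact Hcz].
Qed.

(** On at most two points every permutation squares to the identity, so by faithfulness every
    element of [G] would. *)
Lemma third_point (x y : Omega) : exists z, z <> x /\ z <> y.
Proof.
  apply NNPP. intros Hno.
  assert (Hxy : forall z, z = x \/ z = y).
  { intros z. apply NNPP. intros H. apply Hno. exists z. tauto. }
  destruct branch as (A1 & _).
  destruct (rigid_non_involution x0 y1 A1) as (a & [Ga _] & [v Hv]).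
  apply Hv. apply (faithful (fun x => a (a x))); [now apply G_comp|].
  intros w. rewrite act_comp by auto.
  destruct (Hxy w) as [Ew|Ew], (Hxy (act a w)) as [E1|E1], (Hxy (act a (act a w))) as [E2|E2];
    try congruence; apply (act_inj a); auto; congruence.
Qed.

Lemma omega_inhabited : inhabited Omega.
Proof.
  apply NNPP. intros Hno. destruct branch as (A1 & _).
  destruct (rigid_ex x0 y1 A1) as (g & Gg & [x Hx] & _).
  apply Hx. apply faithful; auto. intros w. exfalso. apply Hno. now constructor.
Qed.

Lemma two_transitive a b a' b' : a <> b -> a' <> b' ->
  exists g, G g /\ act g a = a' /\ act g b = b'.
Proof.
  intros H H'. destruct (third_point a b) as (c & ? & ?), (third_point a' b') as (c' & ? & ?).
  destruct (three a b c a' b' c') as (g & ? & ? & ? & _); auto. eauto.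
Qed.

Lemma transitive a a' : exists g, G g /\ act g a = a'.
Proof.
  destruct (third_point a a) as (b & ? & _), (third_point a' a') as (b' & ? & _).
  destruct (two_transitive a b a' b') as (g & ? & ? & _); auto. eauto.
Qed.

(** * The stabilizer of a point *)

Section PointStabilizer.
Variable o : Omega.
Notation H := (fun g => G g /\ act g o = o).

Lemma stabilizer_transitive_off x y : x <> o -> y <> o ->
  exists g, H g /\ act g x = y.
Proof.
  intros Hx Hy. destruct (two_transitive o x o y) as (g & ? & ? & ?); auto. eauto.
Qed.

(** By 2-transitivity the elements outside the stabilizer form a single double coset. *)
Lemma two_transitive_stabilizer_coreless : coreless adj H.
Proof.
  destruct branch as (A1 & A2 & _ & N12 & _).
  destruct (third_point o o) as (z & Hz & _). destruct (transitive o z) as (g1 & G1 & E1).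
  apply (two_cosets_coreless adj tree G H g1); auto; try tauto.
  - now apply (dynamic_branch_no_leaf adj tree G HG x0 y1 y2).
  - apply HG.
  - intros [_ E]. congruence.
  - intros g Gg Hg. destruct (two_transitive o (act g1 o) o (act g o)) as (k & Gk & Ek & Ek').
    + congruence.
    + intros E. apply Hg. auto.
    + destruct (stabilizer_double_coset G o g1 g k) as (k' & Hk' & F); auto.
      exists k, k'. auto.
Qed.

Lemma end_fixing_stabilizer_conjugate f : endless adj G -> end_map f ->
  (forall g v, H g -> f (g v) = g (f v)) ->
  conjugate_to_orbit adj G act (fun n => Nat.iter n f x0).
Proof.
  intros Gend Hf Hfix. set (xi := fun n => Nat.iter n f x0).
  assert (Hstab : forall g, H g -> ray_equiv V (fun n => g (xi n)) xi).
  { intros g Hg. destruct (G_inverse g (proj1 Hg)) as (g' & _ & E & E' & _).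
    apply (end_map_fixed_iff adj tree f g g' x0); auto. now apply G_aut. }
  (* The stabilizer of a point is maximal, so it is the full stabilizer of the end. *)
  assert (Hmax : forall g, G g -> ray_equiv V (fun n => g (xi n)) xi -> act g o = o).
  { intros g Gg Hg. apply NNPP. intros Hne. apply (Gend f Hf).
    destruct (G_inverse g Gg) as (g' & Gg' & E & E' & _).
    assert (Hgf : forall v, f (g v) = g (f v)).
    { apply (end_map_fixed_iff adj tree f g g' x0); auto. now apply G_aut. }
    intros h v Gh. destruct (classic (act h o = o)) as [Ho|Ho]; [apply Hfix; auto|].
    (* An element outside the stabilizer is [k g k'^-1], a product of elements fixing the end; so
       all of [G] would fix it. *)
    destruct (two_transitive o (act g o) o (act h o)) as (k & Gk & Ek & Ek'); auto.
    destruct (stabilizer_double_coset G o g h k) as (k' & Hk' & F); auto.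
    destruct (G_inverse k' (proj1 Hk')) as (i & Gi & F1 & _).
    rewrite <- (F1 v). rewrite (Hfix k') by auto. rewrite <- !F.
    rewrite (Hfix k) by auto. now rewrite Hgf. }
  (* The point [w = rep w o] will be sent to the end [rep w xi]. *)
  set (rep := fun w => proj1_sig (constructive_indefinite_description _ (transitive o w))).
  assert (Hrep : forall w, G (rep w) /\ act (rep w) o = w).
  { intros w. unfold rep. now destruct (constructive_indefinite_description _ (transitive o w)). }
  assert (Heq : forall g h, G g -> G h ->
            (ray_equiv V (fun n => g (xi n)) (fun n => h (xi n)) <-> act g o = act h o)).
  { intros g h Gg Gh. destruct (G_inverse h Gh) as (h' & Gh' & E & E' & F & F'). split.
    - intros Hr. apply (ray_equiv_map h') in Hr.
      assert (Ho : act (fun x => h' (g x)) o = o).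
      { apply Hmax; [now apply G_comp|]. destruct Hr as (i & j & Hr). exists i, j.
        intros n. rewrite Hr. apply E'. }
      rewrite act_comp in Ho by auto. rewrite <- Ho at 2. now rewrite F.
    - intros Ho. assert (Hh : H (fun x => h' (g x))).
      { split; [now apply G_comp|]. rewrite act_comp by auto. rewrite Ho. apply F'. }
      apply Hstab in Hh. apply (ray_equiv_map h) in Hh.
      destruct Hh as (i & j & Hh). exists i, j. intros n. rewrite <- Hh. now rewrite E. }
  exists (fun w n => rep w (xi n)). repeat split.
  - destruct (G_aut (rep w) (proj1 (Hrep w))) as (Hadj & _).
    apply (proj1 (Hadj _ _)). exact (end_map_adj adj f Hf _).
  - destruct (G_aut (rep w) (proj1 (Hrep w))) as (_ & Hinj & _).
    intros E. apply Hinj in E. revert E. apply Hf.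
  - intros w. exists (rep w). split; [apply Hrep|]. apply Heq; auto; apply Hrep.
  - intros g Gg. exists (act g o). apply Heq; auto; apply Hrep.
  - intros w w' Hr. apply Heq in Hr; try apply Hrep.
    destruct (Hrep w) as [_ E], (Hrep w') as [_ E']. congruence.
  - intros g w Gg. apply (Heq _ (fun x => g (rep w x))).
    + apply Hrep.
    + apply G_comp; [exact Gg|apply Hrep].
    + destruct (Hrep w) as [Gr E]. rewrite (act_comp g (rep w)), E by auto. apply Hrep.
Qed.

(** * Exclusion of point stabilizers that move any half-tree into any other *)

Section DynamicStabilizer.
Hypothesis Hdyn : dynamic adj H.
Hypothesis Hend : endless adj H.

(** If the group of one half-tree fixed [o], so would that of every half-tree, by conjugation inside
    the stabilizer; conjugation in [G] then makes its elements fix all points. *)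
Lemma rigid_moves_point p q : adj p q -> exists a, rigid p q a /\ act a o <> o.
Proof.
  intros Hpq. apply NNPP. intros Hno.
  assert (Hfix : forall a, rigid p q a -> act a o = o).
  { intros a Ha. apply NNPP. eauto. }
  destruct (rigid_ex p q Hpq) as (b & Gb & [x Hx] & Sb). apply Hx.
  apply (faithful b Gb). intros w.
  destruct (transitive o w) as (g & Gg & <-).
  destruct (G_inverse g Gg) as (g' & Gg' & E & E' & F & F').
  assert (Hg'pq : adj (g' p) (g' q)) by (apply (proj1 (proj1 (G_aut g' Gg') _ _)); exact Hpq).
  destruct (Hdyn (g' p) (g' q) p q Hg'pq Hpq) as (h & [Gh Ho] & Hh).
  destruct (G_inverse h Gh) as (h' & Gh' & K & K' & L & L').
  assert (Hb : rigid p q (fun x => h (g' (b (g (h' x)))))).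
  { apply (rigid_transport (g' p) (g' q) p q h h' (fun x => g' (b (g x)))); auto.
    apply rigid_conj; auto. now split. }
  apply Hfix in Hb.
  rewrite (act_conj h h' (fun x => g' (b (g x)))) in Hb; auto.
  2: { apply (G_comp g' (fun x => b (g x))); [auto|now apply G_comp]. }
  rewrite (act_conj g' g b) in Hb by auto.
  assert (Ho' : act h' o = o) by (rewrite <- Ho at 1; apply L').
  rewrite Ho' in Hb. rewrite <- Ho in Hb at 2. apply act_inj in Hb; [|exact Gh].
  rewrite <- Hb at 2. now rewrite F.
Qed.

(** * Half-tree groups do not all act freely at [o] *)

Section Free.
Hypothesis free : forall p q a, adj p q -> rigid p q a -> act a o = o -> forall x, a x = x.

Let b3 : adj y3 x0.
Proof. apply (adj_sym adj tree), branch. Qed.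

(** Freeness turns [e o = b o] into [e = b], and then [e^-1 o = c o] into [b c = 1], impossible
    since [b] is non-trivial with support disjoint from that of [c]. *)
Lemma free_no_match v w b c e e' x1 x2 : adj v w -> adj x0 x1 -> adj x0 x2 ->
  x1 <> x2 -> x1 <> y3 -> x2 <> y3 ->
  rigid x0 x1 b -> (exists x, b x <> x) -> rigid x0 x2 c -> G e' ->
  (forall x, e (e' x) = x) -> (forall x, e' (e x) = x) ->
  rigid v w e -> rigid v w b -> act e o = act b o -> act e' o = act c o -> False.
Proof.
  intros Hvw A1 A2 N12 N13 N23 Hb [x Hx] Hc Ge' E E' He Hbv Eb Ec.
  assert (He' : rigid v w e') by now apply rigid_inverse with e.
  assert (Heb : forall x, e' (b x) = x).
  { apply (free v w (fun x => e' (b x)) Hvw); [now apply rigid_comp|].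
    rewrite (act_comp e' b), <- Eb, <- (act_comp e' e); [now apply act_trivial|..];
      first [apply He'|apply Hb|apply He]. }
  assert (Hbe : forall x, b x = e x).
  { intros z. rewrite <- (E (b z)). now rewrite Heb. }
  assert (Hbc : forall x, b (c x) = x).
  (* [side y3 x0] contains the supports of both [b] and [c]. *)
  { apply (free y3 x0 (fun x => b (c x)) b3).
    - apply rigid_comp; [revert Hb|revert Hc]; apply rigid_mono, side_incl_next; auto.
    - rewrite (act_comp b c), <- Ec; [|apply Hb|apply Hc].
      rewrite <- (act_comp b e'); [|apply Hb|apply He'].
      apply act_trivial. intros z. rewrite Hbe. apply E. }
  apply Hx. rewrite <- (Hbc x) at 2. f_equal. symmetry. apply Hc. intros Hx2.
  destruct Hb as [_ Sb]. apply (side_disj_fork adj tree x0 x1 x2 A1 A2 N12) with x; auto.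
  apply NNPP. intros Hx1. auto.
Qed.

(* Take [r] fixing [o] with [a o |-> b o] and [a^-1 o |-> c o], where [b] and [c] have
   disjoint supports.  The complement of the support of [r a r^-1] meets that of [b]
   or of [c] in a half-tree, so by freeness [r a r^-1 = b] or [r a^-1 r^-1 = c]. *)
Lemma rigid_not_free : False.
Proof.
  pose proof branch as (A1 & A2 & A3 & N12 & N13 & N23).
  destruct (rigid_non_involution x0 y1 A1) as (a & Ha & [x Hx]).
  destruct (rigid_ex x0 y1 A1) as (b & Gb & Hbx & Sb).
  destruct (rigid_ex x0 y2 A2) as (c & Gc & Hcx & Sc).
  destruct (G_inverse a (proj1 Ha)) as (a' & Ga' & E & E' & F & F').
  assert (Ha' : rigid x0 y1 a') by now apply rigid_inverse with a.
  assert (Hb : rigid x0 y1 b) by now split.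
  assert (Hc : rigid x0 y2 c) by now split.
  assert (Hao : act a o <> o).
  { intros Ho. apply Hx. now rewrite !(free x0 y1 a A1 Ha Ho). }
  assert (Hao' : act a' o <> o).
  { intros Ho. apply Hao. rewrite <- Ho at 1. apply F. }
  (* Otherwise the square of [a] would fix [o], and [a] would be an involution by freeness. *)
  assert (Haa' : act a o <> act a' o).
  { intros Ho. apply Hx. apply (free x0 y1 (fun z => a (a z)) A1); [now apply rigid_comp|].
    rewrite (act_comp a a) by apply Ha. rewrite Ho. apply F. }
  assert (Hbo : act b o <> o).
  { intros Ho. destruct Hbx as [z Hz]. apply Hz. now apply (free x0 y1). }
  assert (Hco : act c o <> o).
  { intros Ho. destruct Hcx as [z Hz]. apply Hz. now apply (free x0 y2). }
  assert (Hbc : act b o <> act c o).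
  { intros Ho. destruct (G_inverse b Gb) as (b' & Gb' & K & K' & L & L').
    assert (Hb' : rigid x0 y1 b') by now apply rigid_inverse with b.
    assert (Hcb : forall z, b' (c z) = z).
    { apply (free y3 x0 (fun z => b' (c z)) b3).
      - apply rigid_comp; [revert Hb'|revert Hc]; apply rigid_mono, side_incl_next; auto.
      - rewrite (act_comp b' c), <- Ho by auto. apply L'. }
    destruct Hbx as [z Hz]. apply Hz. rewrite <- (Hcb z) at 1. rewrite K.
    apply Sc. intros H2.
    apply (side_disj_fork adj tree x0 y1 y2 A1 A2 N12) with z; auto.
    apply NNPP. intros H1. auto. }
  destruct (three o (act a o) (act a' o) o (act b o) (act c o)) as (r & Gr & Ro & R1 & R2); auto.
  destruct (G_inverse r Gr) as (r' & Gr' & K & K' & L & L').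
  assert (Ro' : act r' o = o) by (rewrite <- Ro at 1; apply L').
  set (d := fun z => r (a (r' z))). set (d' := fun z => r (a' (r' z))).
  assert (Ed : forall z, d (d' z) = z) by (intros z; unfold d, d'; now rewrite K', E, K).
  assert (Ed' : forall z, d' (d z) = z) by (intros z; unfold d, d'; now rewrite K', E', K).
  assert (Do : act d o = act b o).
  { unfold d. rewrite act_conj, Ro'; auto. apply Ha. }
  assert (Do' : act d' o = act c o).
  { unfold d'. rewrite act_conj, Ro'; auto. }
  assert (Rd : rigid (r x0) (r y1) d) by now apply rigid_conj.
  assert (Rd' : rigid (r x0) (r y1) d') by now apply rigid_conj.
  assert (Ar : adj (r x0) (r y1)) by (apply (proj1 (proj1 (G_aut r Gr) _ _)); exact A1).
  (* Here [side v w] avoids the support of [d] and that of [b] or [c]; both supports lie in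
     [side w v], where freeness compares the two elements. *)
  destruct (half_tree_off_one_of_two adj tree (r y1) (r x0) x0 y1 x0 y2)
    as (v & w & Hvw & Hi & Hd); auto; [now apply (adj_sym adj tree)|now apply side_disj_fork|].
  assert (Awv : adj w v) by now apply (adj_sym adj tree).
  assert (Hsub : forall p q, disj (side v w) (side p q) -> incl (side p q) (side w v)).
  { intros p q D z Hz. apply (side_compl adj tree); [exact Hvw|]. intros Hz'. exact (D z Hz' Hz). }
  assert (Hdv : incl (side (r x0) (r y1)) (side w v)).
  { apply Hsub. intros z Hz Hz'. apply (side_disj adj tree _ _ Ar z Hz'). auto. }
  assert (Hdw : rigid w v d) by (revert Rd; now apply rigid_mono).
  assert (Hdw' : rigid w v d') by (revert Rd'; now apply rigid_mono).
  destruct Hd as [D|D]; apply Hsub in D.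
  - apply (free_no_match w v b c d d' y1 y2); auto; try apply Rd'.
    revert Hb. now apply rigid_mono.
  - apply (free_no_match w v c b d' d y2 y1); auto; try apply Rd.
    revert Hc. now apply rigid_mono.
Qed.
End Free.

(** Triviality for one half-tree would spread to all by conjugation inside the stabilizer of [o],
    which is the excluded free case. *)
Lemma rigid_stabilizer_nontrivial p q : adj p q ->
  exists h, rigid p q h /\ act h o = o /\ exists x, h x <> x.
Proof.
  intros Hpq. apply NNPP. intros Hno. apply rigid_not_free. intros p' q' b Hpq' Hb Ho.
  destruct (Hdyn p' q' p q Hpq' Hpq) as (k & [Gk Ko] & Hk).
  destruct (G_inverse k Gk) as (k' & Gk' & E & E' & F & F').
  assert (Ko' : act k' o = o) by (rewrite <- Ko at 1; apply F').
  intros x. apply NNPP. intros Hx. apply Hno. exists (fun z => k (b (k' z))). repeat split.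
  - apply (G_comp k (fun z => b (k' z))); [auto|]. apply G_comp; [apply Hb|auto].
  - now apply (rigid_transport p' q' p q).
  - rewrite act_conj, Ko', Ho; auto. apply Hb.
  - exists (k x). rewrite E'. intros Hkx. apply Hx. now apply (G_aut k Gk).
Qed.

(** * The half-trees whose groups move a given point, and the end they define *)

Definition moved (eta : Omega) (p q : V) : Prop :=
  adj p q /\ exists h, rigid p q h /\ act h o = o /\ act h eta <> eta.

Lemma not_moved eta p q h : adj p q -> ~ moved eta p q -> rigid p q h -> act h o = o ->
  act h eta = eta.
Proof. intros Hpq Hn Hh Ho. apply NNPP. intros Hm. apply Hn. split; eauto. Qed.

(** Suppose elements with disjoint supports that move [o] always send it to the same point. For [h]
    fixing [o], one of [a], [b] and one of their conjugates by [h] have disjoint supports, so [h]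
    fixes [a o]; 3-transitivity provides an [h] that does not. *)
Lemma commuting_distinct_moves : exists p q p' q' a b,
  adj p q /\ adj p' q' /\ disj (side p q) (side p' q') /\
  rigid p q a /\ rigid p' q' b /\ act a o <> o /\ act b o <> o /\ act a o <> act b o.
Proof.
  pose proof branch as (A1 & A2 & _ & N12 & _). apply NNPP. intros Hno.
  assert (Heq : forall p q p' q' a b, adj p q -> adj p' q' -> disj (side p q) (side p' q') ->
            rigid p q a -> rigid p' q' b -> act a o <> o -> act b o <> o -> act a o = act b o).
  { intros p q p' q' a b ? ? ? ? ? ? ?. apply NNPP. intros Hne. apply Hno.
    exists p, q, p', q', a, b. repeat split; auto; firstorder. }
  destruct (rigid_moves_point x0 y1 A1) as (a & Ha & Hao).
  destruct (rigid_moves_point x0 y2 A2) as (b & Hb & Hbo).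
  assert (D : disj (side x0 y1) (side x0 y2)) by now apply side_disj_fork.
  assert (Eab : act a o = act b o) by now apply (Heq x0 y1 x0 y2).
  destruct (third_point o (act a o)) as (t & Ht & Hta).
  destruct (three o (act a o) t o t (act a o)) as (h & Gh & Ho & H1 & _); auto.
  apply Hta. rewrite <- H1. clear H1 Hta Ht t.
  destruct (G_inverse h Gh) as (h' & Gh' & E & E' & F & F').
  assert (Ho' : act h' o = o) by (rewrite <- Ho at 1; apply F').
  assert (Hc : forall g, G g -> act (fun z => h (g (h' z))) o = act h (act g o)).
  { intros g Gg. now rewrite act_conj, Ho'. }
  assert (Hm : forall g, G g -> act g o <> o -> act (fun z => h (g (h' z))) o <> o).
  { intros g Gg Hg. rewrite Hc by auto. intros Hh. apply Hg.
    apply (act_inj h); auto. now rewrite Ho. }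
  assert (Hadj : forall p q, adj p q -> adj (h p) (h q))
    by (intros p q; apply (proj1 (proj1 (G_aut h Gh) _ _))).
  assert (Ra : rigid (h x0) (h y1) (fun z => h (a (h' z)))) by now apply rigid_conj.
  assert (Rb : rigid (h x0) (h y2) (fun z => h (b (h' z)))) by now apply rigid_conj.
  assert (Dh : disj (side (h x0) (h y1)) (side (h x0) (h y2))).
  { apply side_disj_fork; auto. intros Hy. apply N12. now apply (G_aut h Gh). }
  destruct (disjoint_cross_pair adj tree x0 y1 x0 y2 (h x0) (h y1) (h x0) (h y2))
    as [D'|[D'|[D'|D']]]; auto.
  - rewrite <- (Hc a (proj1 Ha)). symmetry.
    eapply (Heq _ _ _ _ _ _ A1 (Hadj _ _ A1)); eauto. apply Hm; [apply Ha|exact Hao].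
  - rewrite Eab at 1. rewrite <- (Hc b (proj1 Hb)). symmetry.
    eapply (Heq _ _ _ _ _ _ A1 (Hadj _ _ A2)); eauto. apply Hm; [apply Hb|exact Hbo].
  - rewrite <- (Hc a (proj1 Ha)), Eab. symmetry.
    eapply (Heq _ _ _ _ _ _ A2 (Hadj _ _ A1)); eauto. apply Hm; [apply Ha|exact Hao].
  - rewrite Eab, <- (Hc b (proj1 Hb)). symmetry.
    eapply (Heq _ _ _ _ _ _ A2 (Hadj _ _ A2)); eauto. apply Hm; [apply Hb|exact Hbo].
Qed.

Lemma commuting_fixes p q p' q' c k : disj (side p q) (side p' q') ->
  rigid p q c -> rigid p' q' k -> act k o = o -> act k (act c o) = act c o.
Proof. intros D Hc Hk Ho. rewrite <- (rigid_commute p q p' q'), Ho; auto. Qed.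

(* If [eta] and [zeta = k eta] are both moved by the point stabilizers of two disjoint
   half-tree groups, choose [g] fixing [o] with [a o |-> eta], [b o |-> zeta]: one of
   [g a g^-1], [g b g^-1] commutes with one of these groups. *)
Lemma moved_meet eta p q p' q' : moved eta p q -> moved eta p' q' ->
  ~ disj (side p q) (side p' q').
Proof.
  intros [Hpq (k & Hk & Ko & Hke)] [Hpq' (l & Hl & Lo & Hle)] D.
  set (zeta := act k eta).
  assert (Heo : eta <> o) by (intros ->; auto).
  assert (Hzo : zeta <> o).
  { intros Hz. apply Heo. apply (act_inj k); [apply Hk|]. fold zeta. congruence. }
  assert (Hkz : act k zeta <> zeta).
  { intros Hz. apply Hke. now apply (act_inj k); [apply Hk|]. }
  (* [l] commutes with [k], so it moves [zeta = k eta] as it moves [eta]. *)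
  assert (Hlz : act l zeta <> zeta).
  { unfold zeta. rewrite <- (rigid_commute p q p' q'); auto. intros Hz. apply Hle.
    now apply (act_inj k); [apply Hk|]. }
  destruct commuting_distinct_moves
    as (v & w & v' & w' & a & b & Hvw & Hvw' & Dv & Ha & Hb & Hao & Hbo & Hab).
  destruct (three o (act a o) (act b o) o eta zeta) as (g & Gg & Go & G1 & G2); auto.
  destruct (G_inverse g Gg) as (g' & Gg' & E & E' & F & F').
  assert (Go' : act g' o = o) by (rewrite <- Go at 1; apply F').
  assert (Hc : forall c, G c -> act (fun z => g (c (g' z))) o = act g (act c o)).
  { intros c Gc. now rewrite act_conj, Go'. }
  assert (Hadj : forall p q, adj p q -> adj (g p) (g q))
    by (intros x y; apply (proj1 (proj1 (G_aut g Gg) _ _))).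
  assert (Hfix : forall x y s t c m, disj (side (g x) (g y)) (side s t) ->
            rigid x y c -> rigid s t m -> act m o = o ->
            act m (act g (act c o)) = act g (act c o)).
  { intros x y s t c m Dx Rc Rm Mo. rewrite <- (Hc c (proj1 Rc)).
    apply (commuting_fixes (g x) (g y) s t); auto. now apply rigid_conj. }
  assert (Dg : disj (side (g v) (g w)) (side (g v') (g w'))).
  { apply (side_image adj tree g v w (fun z => ~ side (g v') (g w') z)); auto using G_aut.
    intros x Hx Hx'. apply (Dv x Hx). apply NNPP. intros Hn.
    apply (side_compl adj tree) in Hn; [|exact Hvw'].
    apply (side_automorphism adj g) in Hn; [|now apply G_aut].
    exact (side_disj adj tree _ _ (Hadj _ _ Hvw') _ Hx' Hn). }
  destruct (disjoint_cross_pair adj tree (g v) (g w) (g v') (g w') p q p' q')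
    as [D'|[D'|[D'|D']]]; auto.
  - apply Hke. rewrite <- G1. now apply (Hfix v w p q).
  - apply Hle. rewrite <- G1. now apply (Hfix v w p' q').
  - apply Hkz. rewrite <- G2. now apply (Hfix v' w' p q).
  - apply Hlz. rewrite <- G2. now apply (Hfix v' w' p' q').
Qed.

Lemma moved_filter eta : half_tree_filter adj (moved eta).
Proof.
  split; [|split].
  - now intros p q [].
  - intros p q p' q' Hpq' [Hpq (h & Hh & Ho & He)] Hi. split; [exact Hpq'|].
    exists h. repeat split; auto; [apply Hh|]. revert Hh. now apply rigid_mono.
  - apply moved_meet.
Qed.

Lemma moved_equivariant g eta p q : H g -> moved eta p q -> moved (act g eta) (g p) (g q).
Proof.
  intros [Gg Go] [Hpq (h & Hh & Ho & He)].
  destruct (G_inverse g Gg) as (g' & Gg' & E & E' & F & F'). split.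
  - now apply (proj1 (proj1 (G_aut g Gg) _ _)).
  - exists (fun z => g (h (g' z))). split; [now apply rigid_conj|].
    assert (Go' : act g' o = o) by (rewrite <- Go at 1; apply F').
    rewrite !act_conj; auto; try apply Hh. split; [congruence|].
    rewrite F'. intros Hge. apply He. now apply (act_inj g).
Qed.

(** A non-trivial element fixing [o] moves some other point, which the stabilizer of [o] can carry
    to [eta]. *)
Lemma moved_nonempty eta : eta <> o -> exists p q, moved eta p q.
Proof.
  intros Heo. apply NNPP. intros Hno. destruct branch as (A1 & _).
  destruct (rigid_stabilizer_nontrivial x0 y1 A1) as (h & Hh & Ho & [x Hx]). apply Hx.
  apply faithful; [apply Hh|]. intros w. destruct (classic (w = o)) as [->|Hw]; [exact Ho|].
  apply NNPP. intros Hm. apply Hno.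
  destruct (stabilizer_transitive_off w eta Hw Heo) as (g & Hg & <-).
  exists (g x0), (g y1). apply moved_equivariant; [exact Hg|]. split; eauto.
Qed.

(** 3-transitivity makes the stabilizer of [o] 2-transitive on the other points, so the double coset
    argument applies inside it. *)
Lemma two_point_stabilizer_coreless eta : eta <> o ->
  coreless adj (fun g => H g /\ act g eta = eta).
Proof.
  intros Heo. destruct branch as (A1 & A2 & _ & N12 & _).
  pose proof (stabilizer_subgroup G o HG (fun _ h => h)) as HH.
  destruct (third_point o eta) as (z & Hzo & Hze).
  destruct (stabilizer_transitive_off eta z Heo Hzo) as (g1 & H1 & E1).
  assert (Hoff : forall g, H g -> act g eta <> o).
  { intros g [Gg Go] Hg. apply Heo. apply (act_inj g); congruence. }
  apply (two_cosets_coreless adj tree H (fun g => H g /\ act g eta = eta) g1); auto; try tauto.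
  - now apply (dynamic_branch_no_leaf adj tree G HG x0 y1 y2).
  - apply HH.
  - intros [_ E]. congruence.
  - intros g Hg Hn. destruct (three o eta (act g1 eta) o eta (act g eta)) as (k & Gk & Ko & Ke & Kg); auto.
    + intros E. apply (Hoff g1); auto.
    + congruence.
    + intros E. apply (Hoff g); auto.
    + destruct (stabilizer_double_coset H eta g1 g k) as (k' & Hk' & F); auto; [tauto|].
      exists k, k'. auto.
Qed.

(** The filter is invariant under the stabilizer of [o] and [eta], which preserves no non-empty set
    inside a half-tree; only the end remains. *)
Lemma moved_end eta : eta <> o ->
  exists f, end_map f /\ forall v w, moved eta v w <-> f v = w.
Proof.
  intros Heo. destruct (moved_nonempty eta Heo) as (p & q & Hpq).
  pose proof (stabilizer_subgroup G o HG (fun _ h => h)) as HH.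
  destruct (invariant_filter_end_or_core adj tree (fun g => H g /\ act g eta = eta) (moved eta) p q)
    as [(f & Hf & HM & _)|(S & Hne & Hi & Hinv)]; auto.
  - apply stabilizer_subgroup; [exact HH|tauto].
  - apply moved_filter.
  - intros g v w [Hg Hge] Hm. rewrite <- Hge. now apply moved_equivariant.
  - eauto.
  - exfalso. apply (two_point_stabilizer_coreless eta Heo p q S); auto. apply Hpq.
Qed.

(** One inclusion between two such filters would by 3-transitivity give all of them; they would
    define a single end, fixed by the stabilizer of [o]. *)
Lemma moved_separates eta theta : eta <> o -> theta <> o -> eta <> theta ->
  exists v w, moved eta v w /\ ~ moved theta v w.
Proof.
  intros Heo Hto Het. apply NNPP. intros Hno.
  assert (Hsub : forall v w, moved eta v w -> moved theta v w).
  { intros v w Hm. apply NNPP. intros Hn. apply Hno. eauto. }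
  assert (Hall : forall eta', eta' <> o -> forall v w, moved eta' v w -> moved eta v w).
  { intros eta' Ho' v w Hm. destruct (classic (eta' = eta)) as [->|Hne]; [exact Hm|].
    destruct (three o eta theta o eta' eta) as (g & Gg & Go & G1 & G2); auto.
    destruct (G_inverse g Gg) as (g' & Gg' & E & E' & F & F').
    assert (Hg' : H g') by (split; [auto|rewrite <- Go at 1; apply F']).
    apply (moved_equivariant g') in Hm; [|exact Hg'].
    rewrite <- G1, F' in Hm. apply Hsub in Hm.
    apply (moved_equivariant g) in Hm; [|split; auto]. now rewrite G2, !E in Hm. }
  destruct (moved_end eta Heo) as (f & Hf & HM). apply (Hend f Hf).
  intros g v Hg. apply HM. apply (Hall (act g eta)).
  - intros E. apply Heo. apply (act_inj g); [apply Hg|]. destruct Hg. congruence.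
  - apply moved_equivariant; [exact Hg|]. now apply HM.
Qed.

(** The point [eta] is [a^-1 b o], equally [b a^-1 o]. Deep toward its end lies a half-tree whose
    elements fixing [o] fix [a^-1 o] and [b o] and commute with [a] or with [b]; hence they fix
    [eta], although one of them moves it. *)
Lemma dynamic_stabilizer_absurd : False.
Proof.
  destruct commuting_distinct_moves
    as (p & q & p' & q' & a & b & Hpq & Hpq' & D & Ha & Hb & Hao & Hbo & Hab).
  destruct (G_inverse a (proj1 Ha)) as (a' & Ga' & E & E' & F & F').
  assert (Ha' : rigid p q a') by now apply rigid_inverse with a.
  assert (Hao' : act a' o <> o).
  { intros Ho. apply Hao. rewrite <- Ho at 1. apply F. }
  set (eta := act a' (act b o)).
  assert (Eeta : eta = act b (act a' o)) by now apply (rigid_commute p q p' q').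
  assert (Heo : eta <> o).
  { intros Ho. apply Hab. rewrite <- Ho at 1. apply F. }
  assert (Het : eta <> act a' o).
  { intros Ho. apply Hbo. now apply (act_inj a'). }
  assert (Hek : eta <> act b o).
  { rewrite Eeta. intros Ho. apply Hao'. apply (act_inj b) in Ho; [exact Ho|apply Hb]. }
  destruct (moved_end eta Heo) as (f & Hf & HM).
  destruct (moved_separates eta (act a' o)) as (v1 & w1 & M1 & N1); auto.
  destruct (moved_separates eta (act b o)) as (v2 & w2 & M2 & N2); auto.
  apply HM in M1 as E1. apply HM in M2 as E2. subst w1 w2.
  (* The end of [eta] lies outside at least one of the two disjoint half-trees. *)
  assert (H4 : exists v4, disj (side v4 (f v4)) (side p q) \/ disj (side v4 (f v4)) (side p' q')).
  { destruct (end_map_or adj f Hf p q Hpq) as [Ep|Eq].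
    - destruct (end_map_or adj f Hf p' q' Hpq') as [Ep'|Eq'].
      + exfalso. apply (end_map_meet adj tree f Hf p p'). now rewrite Ep, Ep'.
      + exists q'. right. rewrite Eq'. apply side_disj; auto. now apply (adj_sym adj tree).
    - exists q. left. rewrite Eq. apply side_disj; auto. now apply (adj_sym adj tree). }
  destruct H4 as [v4 H4].
  destruct (end_map_lower_bound adj tree f Hf v1 v2) as (v3 & I1 & I2).
  destruct (end_map_lower_bound adj tree f Hf v3 v4) as (v & I3 & I4).
  assert (Mv : moved eta v (f v)) by now apply HM.
  destruct Mv as [Hv (k & Hk & Ko & Hke)].
  assert (K1 : act k (act a' o) = act a' o).
  { apply (not_moved _ v1 (f v1)); auto; [apply M1|].
    revert Hk. apply rigid_mono. intros z Hz. auto. }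
  assert (K2 : act k (act b o) = act b o).
  { apply (not_moved _ v2 (f v2)); auto; [apply M2|].
    revert Hk. apply rigid_mono. intros z Hz. auto. }
  apply Hke. destruct H4 as [D4|D4].
  - unfold eta. rewrite (rigid_commute v (f v) p q), K2; auto. intros z Hz. apply D4. auto.
  - rewrite Eeta. rewrite (rigid_commute v (f v) p' q'), K1; auto. intros z Hz. apply D4. auto.
Qed.
End DynamicStabilizer.
End PointStabilizer.
End Rigid.
End Actions.

(** * From the stabilizer of a point to an orbit of ends *)

Theorem theorem1p4 (V : Type) (adj : V -> V -> Prop) (G : (V -> V) -> Prop)
  (Omega : Type) (act : (V -> V) -> Omega -> Omega) :
  is_simplicial_tree V adj ->
  is_aut_subgroup V adj G ->
  minimal_action V adj G ->
  general_type V adj G ->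
  ~ topologically_free V adj G ->
  is_action G act ->
  faithful_action G act ->
  three_transitive G act ->
  exists xi0 : nat -> V, is_ray V adj xi0 /\ conjugate_to_orbit adj G act xi0.
Proof.
  intros tree HG Hmin Hgen Hntf Hact faithful three.
  pose proof (general_type_endless adj tree G Hgen) as Gend.
  assert (Gdyn : dynamic adj G).
  { apply coreless_endless_dynamic; auto. now apply minimal_coreless. }
  destruct (general_type_branch adj tree G Hgen) as (x0 & y1 & y2 & y3 & branch).
  pose proof (rigid_nontrivial adj tree G HG x0 y1 y2 y3 branch Gdyn Hntf) as rigid_ex.
  destruct (omega_inhabited adj G act faithful x0 y1 y2 y3 branch rigid_ex) as [o].
  assert (Hcore : coreless adj (fun g => G g /\ act g o = o)).
  { now apply (two_transitive_stabilizer_coreless adj tree G HG act Hact faithful three x0 y1 y2 y3). }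
  destruct (classic (endless adj (fun g => G g /\ act g o = o))) as [Hend|Hfix].
  - exfalso.
    apply (dynamic_stabilizer_absurd adj tree G HG act Hact faithful three x0 y1 y2 y3
             branch Gdyn rigid_ex o); auto.
    apply coreless_endless_dynamic; auto. now apply (stabilizer_subgroup adj G act Hact).
  - apply not_all_ex_not in Hfix. destruct Hfix as [f Hf].
    apply imply_to_and in Hf. destruct Hf as [Hf Hinv].
    apply imply_to_and in Hinv. destruct Hinv as [Hinv _].
    exists (fun n => Nat.iter n f x0). split; [now apply iter_end_map_is_ray|].
    now apply (end_fixing_stabilizer_conjugate adj tree G HG act Hact faithful three
                 x0 y1 y2 y3 branch rigid_ex o f).
Qed.
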